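(* Let $\delta\ge3$ be odd. If a $\delta$-PHO Hamiltonian $K^{(\delta)}$ is separable within a rotation of Cartesian coordinates, say within $\sigma(\psi)$, then there exists a unique $(2\delta-2)$-PHO Hamiltonian $K^{(2\delta-2)}$ whose BGNF up to degree $2\delta-2$ coincides with that of $K^{(\delta)}$; moreover $K^{(2\delta-2)}$ is separable within the same rotation, i.e. $K^{(2\delta-2)}(\sigma(\psi)^{-1}\tilde q,\sigma(\psi)^{-1}\tilde p)=\tfrac12\sum_j(\tilde p_j^2+\tilde q_j^2)+\tilde w_0\tilde q_2^{2\delta-2}+\tilde w_{2\delta-2}\tilde q_1^{2\delta-2}$ for some real constants $\tilde w_0,\tilde w_{2\delta-2}$.
   Context: For $d\ge3$, a $d$-PHO is the Hamiltonian $K^{(d)}(q,p)=\tfrac12\sum_{j=1}^2(p_j^2+q_j^2)+V^{(d)}(q)$ on $\mathbb R^4$, with $V^{(d)}(q)=\sum_{h=0}^{d}v^{(d)}_h\binom{d}{h}q_1^hq_2^{d-h}$, real coefficients, $V^{(d)}\not\equiv0$. $\sigma(\psi)=\begin{pmatrix}\cos\psi&-\sin\psi\\ \sin\psi&\cos\psi\end{pmatrix}$. A $d$-PHO is separable within a rotation of Cartesian coordinates if there exist $\psi\in[0,2\pi)$ and reals $(\tilde v_0,\tilde v_d)\ne(0,0)$ with $V^{(d)}(\sigma(\psi)^{-1}\tilde q)=\tilde v_0\tilde q_2^{d}+\tilde v_d\tilde q_1^{d}$ for all $\tilde q$. For $x,y\in\mathbb R^2$ let $D_{x,y}=\sum_{j=1}^2\big(x_j\partial/\partial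 y_j-y_j\partial/\partial x_j\big)$ and let $D^{(k)}_{x,y}$ be its restriction to homogeneous polynomials of degree $k$ in $(x,y)$. Given $K$ and $\rho\ge3$, its BGNF up to degree $\rho$ is the polynomial $G(\xi,\eta)=\tfrac12\sum_j(\eta_j^2+\xi_j^2)+\sum_{k=3}^{\rho}G_k(\xi,\eta)$, each $G_k$ homogeneous of degree $k$ with $G_k\in\ker D^{(k)}_{\xi,\eta}$, for which there is $W(q,\eta)=\sum_j q_j\eta_j+\sum_{k=3}^{\rho}W_k(q,\eta)$, each $W_k$ homogeneous of degree $k$ with $W_k\in\operatorname{image}D^{(k)}_{q,\eta}$, such that the power series in $(q,\eta)$ of $K(q,\partial W/\partial q)-G(\partial W/\partial\eta,\eta)$ has no terms of degree $\le\rho$; $G$ is uniquely determined. *)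

(* Defs.v *)
From Stdlib Require Import Reals.
From HB Require Import structures.
From mathcomp Require Import all_boot all_order all_algebra.
From mathcomp Require Import mpoly.
From mathcomp Require Import Rstruct.

Set Implicit Arguments.
Unset Strict Implicit.
Unset Printing Implicit Defensive.

Import Order.TTheory GRing.Theory Num.Theory.
Local Open Scope ring_scope.

(* Variable conventions for polynomials in 4 variables:
   index 0,1 = first pair of coordinates (q_1,q_2) resp. (xi_1,xi_2);
   index 2,3 = second pair (p_1,p_2) resp. (eta_1,eta_2). *)

Definition i4 (k : nat) : 'I_4 := inord k.

Definition harm : {mpoly R[4]} :=
  (2%:R)^-1 *: (\sum_(j < 4) 'X_j ^+ 2).

Definition phoPot (d : nat) (v : 'I_d.+1 -> R) : {mpoly R[2]} :=
  \sum_(h < d.+1) (v h * ('C(d, h))%:R) *: ('X_(inord 0) ^+ h * 'X_(inord 1) ^+ (d - h)).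

Definition phoHam (d : nat) (v : 'I_d.+1 -> R) : {mpoly R[4]} :=
  harm + \sum_(h < d.+1) (v h * ('C(d, h))%:R) *: ('X_(i4 0) ^+ h * 'X_(i4 1) ^+ (d - h)).

Definition isPHO (d : nat) (K : {mpoly R[4]}) : Prop :=
  exists v : 'I_d.+1 -> R, phoPot v != 0 /\ K = phoHam v.

Definition sigma (psi : R) : 'M[R]_2 :=
  \matrix_(i < 2, j < 2)
    (if (i == 0 :> nat) && (j == 0 :> nat) then cos psi
     else if (i == 0 :> nat) then - sin psi
     else if (j == 0 :> nat) then sin psi
     else cos psi).

Definition rotinv (psi : R) (x : 'cV[R]_2) : 'cV[R]_2 := invmx (sigma psi) *m x.

Definition separable_within (d : nat) (v : 'I_d.+1 -> R) (psi : R) : Prop :=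
  exists vt0 vtd : R, (vt0 != 0 \/ vtd != 0) /\
    forall qt : 'cV[R]_2,
      (phoPot v).@[fun i => rotinv psi qt i 0]
        = vt0 * qt (inord 1) 0 ^+ d + vtd * qt (inord 0) 0 ^+ d.

Definition Dop (P : {mpoly R[4]}) : {mpoly R[4]} :=
  \sum_(j < 2)
    ('X_(i4 j) * mderiv (i4 (j + 2)) P - 'X_(i4 (j + 2)) * mderiv (i4 j) P).

Definition inKerD (k : nat) (P : {mpoly R[4]}) : Prop :=
  P \is k.-homog /\ Dop P = 0.

Definition inImD (k : nat) (P : {mpoly R[4]}) : Prop :=
  P \is k.-homog /\ exists F : {mpoly R[4]}, F \is k.-homog /\ Dop F = P.

Definition substK (K W : {mpoly R[4]}) : {mpoly R[4]} :=
  comp_mpoly [tuple (if (i < 2)%N then 'X_i else mderiv (i4 (i - 2)) W) | i < 4] K.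

Definition substG (G W : {mpoly R[4]}) : {mpoly R[4]} :=
  comp_mpoly [tuple (if (i < 2)%N then mderiv (i4 (i + 2)) W else 'X_i) | i < 4] G.

Definition noLowTerms (rho : nat) (P : {mpoly R[4]}) : Prop :=
  forall m : 'X_{1..4}, (mdeg m <= rho)%N -> P@_m = 0.

Definition isBGNF (K : {mpoly R[4]}) (rho : nat) (G : {mpoly R[4]}) : Prop :=
  exists Gk : nat -> {mpoly R[4]},
    (forall k, (3 <= k <= rho)%N -> inKerD k (Gk k)) /\
    G = harm + \sum_(3 <= k < rho.+1) Gk k /\
    exists Wk : nat -> {mpoly R[4]},
      (forall k, (3 <= k <= rho)%N -> inImD k (Wk k)) /\
      let W := \sum_(j < 2) 'X_(i4 j) * 'X_(i4 (j + 2)) + \sum_(3 <= k < rho.+1) Wk k in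
      noLowTerms rho (substK K W - substG G W).

Definition sameBGNF (K K' : {mpoly R[4]}) (rho : nat) : Prop :=
  exists G, isBGNF K rho G /\ isBGNF K' rho G.

Definition rotpt (psi : R) (qt pt : 'cV[R]_2) : 'I_4 -> R :=
  fun i => if (i < 2)%N then rotinv psi qt (inord i) 0 else rotinv psi pt (inord (i - 2)) 0.

(* Main.v *)
Require Import Defs.
From Stdlib Require Import Reals.
From HB Require Import structures.
From mathcomp Require Import all_boot all_order all_algebra.
From mathcomp Require Import ssrcomplements mpoly.
From mathcomp Require Import Rstruct.
From mathcomp Require Import ring zify.
Import Order.TTheory GRing.Theory Num.Theory.
Local Open Scope ring_scope.

(** Let [D = Dop], the generator of the simultaneous rotation of the planes
    [(q_j, p_j)].  It is skew for the Fischer inner product, so [ker D] and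
    [im D] meet trivially, and the normal form is determined degree by degree.

    If [V] is homogeneous of odd degree [d], the normal form of [harm + V] starts
    in degree [2 d - 2], with the [ker D]-part of
    [1/2 (|dW/dq|^2 - |dW/dp|^2)], where [D W = V].  For a separated [V] this
    expression splits into one function per plane.  In a single plane [ker D] is
    spanned by the powers of [q^2 + p^2], so the result is a combination of two
    such powers, which is also the [ker D]-part of a separated potential of degree
    [2 d - 2].  The combination does not vanish: integrating by parts over the
    circle shows that the average of [W_q^2 - W_p^2] is negative.

    The potential of degree [2 d - 2] is unique because an even potential in
    [im D] is zero: its average over the circle [t |-> (x cos t, x sin t)] is a
    positive multiple of its value at [x]. *)

(** * Order of vanishing *)

Section Order.
Context {n : nat} {S : comNzRingType}.
Implicit Types P Q : {mpoly S[n]}.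

(** The strict bound makes [mord rho.+1] convertible to [noLowTerms rho]. *)
Definition mord (e : nat) P := forall m, (mdeg m < e)%N -> P@_m = 0.

Lemma mord0 e : mord e 0.
Proof. by move=> m _; rewrite mcoeff0. Qed.

Lemma mordW e f P : (f <= e)%N -> mord e P -> mord f P.
Proof. by move=> le_fe hP m hm; apply: hP; apply: leq_trans le_fe. Qed.

Lemma mordD e P Q : mord e P -> mord e Q -> mord e (P + Q).
Proof. by move=> hP hQ m hm; rewrite mcoeffD hP ?hQ ?addr0. Qed.

Lemma mordN e P : mord e P -> mord e (- P).
Proof. by move=> hP m hm; rewrite mcoeffN hP ?oppr0. Qed.

Lemma mordB e P Q : mord e P -> mord e Q -> mord e (P - Q).
Proof. by move=> hP hQ; apply: mordD => //; apply: mordN. Qed.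

Lemma mordZ e c P : mord e P -> mord e (c *: P).
Proof. by move=> hP m hm; rewrite mcoeffZ hP ?mulr0. Qed.

Lemma mord_sum e (I : Type) (r : seq I) (C : pred I) (F : I -> {mpoly S[n]}) :
  (forall i, C i -> mord e (F i)) -> mord e (\sum_(i <- r | C i) F i).
Proof. by move=> hF; elim/big_ind: _ => //; [apply: mord0 | move=> *; apply: mordD]. Qed.

Lemma mordM e f P Q : mord e P -> mord f Q -> mord (e + f) (P * Q).
Proof.
move=> hP hQ m hm; rewrite mcoeffM big1 // => k /eqP def_m.
have [lt_e|le_e] := ltnP (mdeg k.1) e; first by rewrite hP ?mul0r.
rewrite hQ ?mulr0 // -(ltn_add2l (mdeg k.1)) -mdegD -def_m.
by apply: leq_trans hm _; rewrite leq_add2r.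
Qed.

Lemma mordX (i : 'I_n) : mord 1 ('X_i : {mpoly S[n]}).
Proof.
move=> m; rewrite ltnS leqn0 mdeg_eq0 => /eqP->.
by rewrite mcoeffX; case: eqP => // /(congr1 mdeg); rewrite mdeg1 mdeg0.
Qed.

Lemma mord_deriv e P i : mord e.+1 P -> mord e P^`M(i).
Proof. by move=> hP m hm; rewrite mcoeff_mderiv hP ?mul0rn // mdegD mdeg1; lia. Qed.

Lemma dhomog_mord k P : P \is k.-homog -> mord k P.
Proof. by move=> hP m hm; apply: (dhomog_nemf_coeff hP); rewrite neq_ltn hm. Qed.

Lemma dhomog_mord_eq0 k P : P \is k.-homog -> mord k.+1 P -> P = 0.
Proof.
move=> hP oP; apply/mpolyP => m; rewrite mcoeff0.
have [/eqP dm|/(dhomog_nemf_coeff hP)//] := boolP (mdeg m == k).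
by apply: oP; rewrite dm.
Qed.

Lemma dhomog_deriv k P i : P \is k.+1.-homog -> P^`M(i) \is k.-homog.
Proof.
move=> hP; apply/dhomogP => m; rewrite mcoeff_msupp mcoeff_mderiv.
apply: contraNeq => dm; rewrite (dhomog_nemf_coeff hP) ?mul0rn //.
by rewrite /= mdegD mdeg1 addn1 eqSS.
Qed.

End Order.

(* Substituting tuples that agree to order [f.+1] into a polynomial of order
   [e] gives results that agree to order [e + f]: each monomial telescopes. *)
Lemma mord_comp {n k : nat} {S : comNzRingType} (e f : nat) (P : {mpoly S[n]})
    (A B : n.-tuple {mpoly S[k]}) :
    (forall i, mord 1 (tnth A i)) -> (forall i, mord 1 (tnth B i)) ->
    (forall i, mord f.+1 (tnth A i - tnth B i)) -> mord e P ->
  mord (e + f) ((P \mPo A) - (P \mPo B)).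
Proof.
move=> oA oB oAB oP.
(* The orders of [a] and [b] are carried along because the difference of two products needs them. *)
pose near d (a b : {mpoly S[k]}) := [/\ mord d a, mord d b & mord (d + f) (a - b)].
have near1 : near 0%N 1 1 by split=> //; rewrite subrr; apply: mord0.
have nearM d d' a b a' b' : near d a b -> near d' a' b' -> near (d + d')%N (a * a') (b * b').
  move=> [oa ob oab] [oa' ob' oab']; split; try exact: mordM.
  have -> : a * a' - b * b' = (a - b) * a' + b * (a' - b') by ring.
  apply: mordD; [apply: (@mordW _ _ (d + f + d')) | apply: (@mordW _ _ (d + (d' + f)))];
    try lia; exact: mordM.
have nearX d a b j : near d a b -> near (d * j)%N (a ^+ j) (b ^+ j).
  move=> ab; elim: j => [|j IHj]; first by rewrite muln0 !expr0.
  by rewrite mulnS !exprS; apply: nearM.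
have near_mono (m : 'X_{1..n}) : near (mdeg m) ('X_[m] \mPo A) ('X_[m] \mPo B).
  rewrite !comp_mpolyX mdegE.
  elim/big_ind3: _ => // [d a b d' a' b'|i _]; first exact: nearM.
  by rewrite -{1}[m i]mul1n; apply: nearX; split; rewrite ?add1n.
rewrite (comp_mpolyEX P A) (comp_mpolyEX P B) -sumrB; apply: mord_sum => m _.
rewrite -scalerBr.
have [lt_me|le_em] := ltnP (mdeg m) e.
  by rewrite oP // scale0r; apply: mord0.
apply: mordZ; case: (near_mono m) => _ _; apply: mordW; lia.
Qed.

(** * Rotations, Fischer product and Gaussian moments *)

Section MonomialFunctional.
Context {n : nat} {S : comNzRingType}.

Definition mlin (l : 'X_{1..n} -> S) (P : {mpoly S[n]}) : S :=
  \sum_(m <- msupp P) P@_m * l m.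

Lemma mlinwE l (P : {mpoly S[n]}) k : (msize P <= k)%N ->
  mlin l P = \sum_(m : 'X_{1..n < k}) P@_m * l m.
Proof.
move=> le_Pk; rewrite /mlin.
pose I : subFinType _ := 'X_{1..n < k}.
rewrite (big_mksub I) ?msupp_uniq //=; last first.
  by move=> m /msize_mdeg_lt /leq_trans; apply.
rewrite big_rmcond //= => m /memN_msupp_eq0 ->.
by rewrite mul0r.
Qed.

Lemma mlin_is_linear l : linear_for *%R (mlin l).
Proof.
move=> c P Q; set k := maxn (msize (c *: P + Q)) (maxn (msize P) (msize Q)).
rewrite !(@mlinwE _ _ k) ?leq_max ?leqnn ?orbT // mulr_sumr -big_split.
by apply: eq_bigr => m _ /=; rewrite mcoeffD mcoeffZ mulrDl mulrA.
Qed.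

HB.instance Definition _ l :=
  GRing.isLinear.Build S {mpoly S[n]} S *%R (mlin l) (mlin_is_linear l).

Lemma mlinX l m : mlin l 'X_[m] = l m.
Proof. by rewrite /mlin msuppX big_seq1 mcoeffX eqxx mul1r. Qed.

Lemma mpoly_linear_ind (C : {mpoly S[n]} -> Prop) :
  C 0 -> (forall c P Q, C P -> C Q -> C (c *: P + Q)) -> (forall m, C 'X_[m]) ->
  forall P, C P.
Proof. by move=> C0 CD CX; elim/mpolyind => // c m P _ _; apply: CD. Qed.

End MonomialFunctional.

Lemma scale_natr {n : nat} {S : comNzRingType} k (P : {mpoly S[n]}) : k%:R *: P = k%:R * P.
Proof. by rewrite scaler_nat mulr_natl. Qed.

Section Rotation.
Context {n : nat} {S : comNzRingType}.
Implicit Types P Q : {mpoly S[n]}.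

Definition rotgen (i j : 'I_n) P := 'X_i * P^`M(j) - 'X_j * P^`M(i).

Lemma rotgen_is_linear i j : linear (rotgen i j).
Proof.
move=> c P Q; rewrite /rotgen !mderivD !mderivZ !mulrDr -!scalerAr scalerBr.
by rewrite opprD addrACA.
Qed.

HB.instance Definition _ i j :=
  GRing.isLinear.Build S {mpoly S[n]} {mpoly S[n]} _ (rotgen i j) (rotgen_is_linear i j).

Lemma rotgenD i j P Q : rotgen i j (P + Q) = rotgen i j P + rotgen i j Q.
Proof. exact: linearD. Qed.

Lemma rotgenZ i j c P : rotgen i j (c *: P) = c *: rotgen i j P.
Proof. exact: linearZ. Qed.

Lemma rotgenM i j P Q : rotgen i j (P * Q) = rotgen i j P * Q + P * rotgen i j Q.
Proof. by rewrite /rotgen !mderivM; ring. Qed.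

Lemma mderivXU (i j : 'I_n) : ('X_j : {mpoly S[n]})^`M(i) = (i == j)%:R.
Proof.
rewrite mderivX mnm1E eq_sym; have [->|_] := eqVneq i j; last by rewrite scale0r.
by rewrite scale1r -{1}[U_(j)%MM]add0m addmK mpolyX0.
Qed.

Lemma dhomogXU (i : 'I_n) : ('X_i : {mpoly S[n]}) \is 1.-homog.
Proof. by rewrite dhomogX /= mdeg1. Qed.

Lemma dhomog_rotgen i j k P : P \is k.-homog -> rotgen i j P \is k.-homog.
Proof.
case: k => [hP|k hP].
  suff -> : P = (P@_0)%:MP by rewrite /rotgen !mderivC !mulr0 subrr dhomog0.
  apply/mpolyP => m; rewrite mcoeffC; case: eqP => [->|/eqP nz]; first by rewrite mulr1.
  by rewrite mulr0 (dhomog_nemf_coeff hP) //= mdeg_eq0.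
have hX l l' : 'X_l * P^`M(l') \is k.+1.-homog.
  by rewrite -add1n; apply: dhomogM; rewrite ?dhomogXU ?dhomog_deriv.
by rewrite /rotgen rpredB ?hX.
Qed.

Lemma euler_homog k P : P \is k.-homog -> \sum_i 'X_i * P^`M(i) = k%:R *: P.
Proof.
move=> hP; rewrite {2}(mpolyE P) scaler_sumr.
have -> : \sum_i 'X_i * P^`M(i) =
    \sum_(m <- msupp P) \sum_i P@_m *: ('X_i * 'X_[m]^`M(i)).
  rewrite exchange_big /=; apply: eq_bigr => i _; rewrite {1}(mpolyE P).
  by rewrite linear_sum mulr_sumr; apply: eq_bigr => m _; rewrite linearZ scalerAr.
apply: eq_big_seq => m hm; rewrite -scaler_sumr scalerA mulrC -scalerA; congr (_ *: _).
have <- : mdeg m = k by have /dhomogP := hP; apply.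
rewrite mdegE natr_sum scaler_suml; apply: eq_bigr => i _.
rewrite mderivX -scalerAr -mpolyXD.
(* At exponent zero the truncated [m - U_(i)] is not undone by adding [U_(i)], but the scalar factor
   vanishes. *)
case: (posnP (m i)) => [->|mi]; first by rewrite !scale0r.
by rewrite addmC submK //; apply/mnm_lepP => l; rewrite mnmE; case: eqP => // <-.
Qed.

End Rotation.

(** * The Fischer inner product *)

Section Fischer.
Context {n : nat} {F : realFieldType}.
Implicit Types P Q : {mpoly F[n]}.

Definition mfact (m : 'X_{1..n}) : nat := (\prod_(i < n) (m i)`!)%N.

(** Monomials are orthogonal with squared norm [mfact m], the weight that makes multiplication by
    ['X_i] adjoint to differentiation. *)
Definition fischer P Q : F := mlin (fun m => Q@_m * (mfact m)%:R) P.

Lemma mfact_gt0 m : (0 < mfact m)%N.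
Proof. by apply: prodn_gt0 => i; apply: fact_gt0. Qed.

Lemma mfactU m i : mfact (m + U_(i)) = ((m i).+1 * mfact m)%N.
Proof.
rewrite /mfact (bigD1 i) //= [in RHS](bigD1 i) //= mnmDE mnm1E eqxx addn1 factS mulnA.
congr (_ * _)%N; apply: eq_bigr => j ne_ji.
by rewrite mnmDE mnm1E eq_sym (negbTE ne_ji) addn0.
Qed.

Lemma fischerC P Q : fischer P Q = fischer Q P.
Proof.
rewrite /fischer !(@mlinwE _ _ _ _ (maxn (msize P) (msize Q))) ?leq_maxl ?leq_maxr //.
by apply: eq_bigr => m _; rewrite mulrCA.
Qed.

Lemma fischerXM i P Q : fischer ('X_i * P) Q = fischer P Q^`M(i).
Proof.
move: P; apply: mpoly_linear_ind => [|c P P' IH IH'|m]; rewrite /fischer.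
- by rewrite mulr0 !linear0.
- by rewrite mulrDr -scalerAr !linearP; congr (_ * _ + _).
- rewrite -mpolyXD !mlinX addmC mfactU mcoeff_mderiv.
  by rewrite natrM mulrA [Q@__ * _]mulr_natr.
Qed.

Lemma fischerBl P P' Q : fischer (P - P') Q = fischer P Q - fischer P' Q.
Proof. exact: linearB. Qed.

Lemma fischerDl P P' Q : fischer (P + P') Q = fischer P Q + fischer P' Q.
Proof. exact: linearD. Qed.

(** Passing to adjoints exchanges the two halves of [rotgen]. *)
Lemma fischer_rotgen i j P Q : fischer (rotgen i j P) Q = - fischer P (rotgen i j Q).
Proof.
rewrite fischerBl !fischerXM [in RHS]fischerC fischerBl !fischerXM opprB.
by rewrite fischerC [X in _ - X]fischerC.
Qed.

Lemma fischer_eq0 P : fischer P P = 0 -> P = 0.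
Proof.
move=> /eqP; rewrite /fischer /mlin psumr_eq0 => [/allP hP|m _]; last first.
  by rewrite mulrA mulr_ge0 // -expr2 sqr_ge0.
apply: msuppnil0; case: (msupp P) (mcoeff_msupp P) hP => // m s hs /(_ m (mem_head _ _)) /=.
have : P@_m != 0 by rewrite -hs mem_head.
by rewrite !mulf_eq0 pnatr_eq0 -leqn0 leqNgt mfact_gt0 !orbF orbb => /negbTE->.
Qed.

End Fischer.

(** * Gaussian moments *)

Section Gauss.
Context {n : nat} {F : realFieldType}.
Implicit Types P Q : {mpoly F[n]}.

(** Moments of a standard Gaussian variable: zero for odd [k], the double factorial of [k - 1] for
    even [k]. *)
Fixpoint gmom (k : nat) : nat :=
  match k with 0%N => 1%N | 1%N => 0%N | (k'.+1 as k1).+1 => (k1 * gmom k')%N end.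

Lemma gmomS k : gmom k.+1 = (k * gmom k.-1)%N.
Proof. by case: k => [|k]. Qed.

Lemma gmom_gt0 k : ~~ odd k -> (0 < gmom k)%N.
Proof.
have [j] := ubnP k; elim: j k => // j IHj [|[|k]] //= lt_kj; rewrite negbK => ok.
by rewrite muln_gt0 /= IHj //; lia.
Qed.

(* Expectation under the standard Gaussian measure, which is invariant under
   rotations; it serves as a purely algebraic average over circles. *)
Definition gauss : {mpoly F[n]} -> F :=
  mlin (fun m => (\prod_(i < n) gmom (m i))%N%:R).

HB.instance Definition _ := GRing.Linear.on gauss.

Lemma gaussB P Q : gauss (P - Q) = gauss P - gauss Q.
Proof. exact: linearB. Qed.

Lemma gaussZ c P : gauss (c *: P) = c * gauss P.
Proof. exact: linearZ. Qed.

(** Gaussian integration by parts; on monomials it is the recursion of [gmom]. *)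
Lemma gaussXM i P : gauss ('X_i * P) = gauss P^`M(i).
Proof.
move: P; apply: mpoly_linear_ind => [|c P P' IH IH'|m].
- by rewrite mulr0 !linear0.
- by rewrite mulrDr -scalerAr mderivD mderivZ !linearP; congr (_ * _ + _).
- rewrite -mpolyXD mderivX /gauss linearZ /= !mlinX -natrM; congr (_%:R).
  rewrite (bigD1 i) //= [in RHS](bigD1 i) //= mnmDE mnmBE mnm1E eqxx add1n gmomS subn1 mulnA.
  congr (_ * _)%N; apply: eq_bigr => j ne_ji.
  by rewrite mnmDE mnmBE mnm1E eq_sym (negbTE ne_ji) add0n subn0.
Qed.

(** Integration by parts turns both halves into the average of the same mixed second derivative. *)
Lemma gauss_rotgen i j P : gauss (rotgen i j P) = 0.
Proof. by rewrite linearB /= !gaussXM mderiv_comm subrr. Qed.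

Lemma gauss_Xn i k : gauss ('X_i ^+ k) = (gmom k)%:R.
Proof.
rewrite mpolyXn /gauss mlinX; congr (_%:R).
rewrite (bigD1 i) //= mulmnE mnm1E eqxx mul1n big1 ?muln1 // => j ne_ji.
by rewrite mulmnE mnm1E eq_sym (negbTE ne_ji) mul0n.
Qed.

(** Nonnegativity of coefficients rather than of values: it survives products and forces a
    nonnegative Gaussian average. *)
Definition mnonneg P := forall m, 0 <= P@_m.

Lemma mnonnegX m : mnonneg 'X_[m].
Proof. by move=> m'; rewrite mcoeffX ler0n. Qed.

Lemma mnonneg1 : mnonneg 1.
Proof. by move=> m'; rewrite mcoeff1 ler0n. Qed.

Lemma mnonnegD P Q : mnonneg P -> mnonneg Q -> mnonneg (P + Q).
Proof. by move=> hP hQ m; rewrite mcoeffD addr_ge0. Qed.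

Lemma mnonnegZ c P : 0 <= c -> mnonneg P -> mnonneg (c *: P).
Proof. by move=> c_ge0 hP m; rewrite mcoeffZ mulr_ge0. Qed.

Lemma mnonnegM P Q : mnonneg P -> mnonneg Q -> mnonneg (P * Q).
Proof. by move=> hP hQ m; rewrite mcoeffM sumr_ge0 // => k _; rewrite mulr_ge0. Qed.

Lemma mnonnegXn P k : mnonneg P -> mnonneg (P ^+ k).
Proof.
by move=> hP; elim: k => [|k IH]; [apply: mnonneg1 | rewrite exprS; apply: mnonnegM].
Qed.

Lemma gauss_ge0 P : mnonneg P -> 0 <= gauss P.
Proof. by move=> hP; apply: sumr_ge0 => m _; rewrite mulr_ge0 ?ler0n. Qed.

End Gauss.

(** * Averages over the circle *)

Section Circle.
Context {F : realFieldType}.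
Implicit Types P Q G : {mpoly F[2]}.

(** Homogeneous stand-ins for cosine and sine; [rr], killed by [D2], stands for 1. *)
Definition cX : {mpoly F[2]} := 'X_0.
Definition sX : {mpoly F[2]} := 'X_1.
Definition rr : {mpoly F[2]} := cX ^+ 2 + sX ^+ 2.
Notation D2 := (@rotgen 2 F 0 1).

Lemma D2E P : D2 P = cX * P^`M(1) - sX * P^`M(0).
Proof. by []. Qed.

Lemma D2c : D2 cX = - sX.
Proof. by rewrite D2E !mderivXU /= mulr0 mulr1 sub0r. Qed.

Lemma D2s : D2 sX = cX.
Proof. by rewrite D2E !mderivXU /= mulr0 mulr1 subr0. Qed.

Lemma rotgenX2 P : D2 (P ^+ 2) = 2%:R * P * D2 P.
Proof. by rewrite expr2 rotgenM; ring. Qed.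

Lemma rotgenXn P k : D2 (P ^+ k.+1) = k.+1%:R * P ^+ k * D2 P.
Proof.
elim: k => [|k IHk]; first by rewrite expr1 expr0 !mul1r.
by rewrite exprS rotgenM IHk [P ^+ k.+1]exprS -[k.+2]addn1 natrD; ring.
Qed.

Lemma D2rr : D2 rr = 0.
Proof. by rewrite linearD /= !rotgenX2 D2c D2s; ring. Qed.

Lemma D2rrM P : D2 (rr * P) = rr * D2 P.
Proof. by rewrite rotgenM D2rr mul0r add0r. Qed.

Lemma dhomog_c k : cX ^+ k \is k.-homog.
Proof. by rewrite -[X in X.-homog]mul1n dhomogMn ?dhomogXU. Qed.

Lemma dhomog_s k : sX ^+ k \is k.-homog.
Proof. by rewrite -[X in X.-homog]mul1n dhomogMn ?dhomogXU. Qed.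

Lemma dhomog_rr k : rr ^+ k \is (2 * k).-homog.
Proof. by rewrite dhomogMn // rpredD ?dhomog_c ?dhomog_s. Qed.

(** In even degree [a] is the mean of [P] over the unit circle; in odd degree that mean is zero and
    [a] is arbitrary. *)
Definition avg_split k P := exists a G,
  G \is k.-homog /\ P = a *: (if odd k then 0 else rr ^+ k./2) + D2 G.

Lemma avg_splitD k P Q : avg_split k P -> avg_split k Q -> avg_split k (P + Q).
Proof.
move=> [a [G [hG ->]]] [b [H [hH ->]]]; exists (a + b), (G + H).
by rewrite rpredD // linearD scalerDl addrACA.
Qed.

Lemma avg_splitZ k c P : avg_split k P -> avg_split k (c *: P).
Proof.
move=> [a [G [hG ->]]]; exists (c * a), (c *: G).
by rewrite rpredZ // linearZ scalerDr scalerA.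
Qed.

Lemma avg_split_im k G : G \is k.-homog -> avg_split k (D2 G).
Proof. by move=> hG; exists 0, G; rewrite scale0r add0r. Qed.

Lemma avg_split_natM k j P : avg_split k (j.+1%:R * P) -> avg_split k P.
Proof.
move=> /(avg_splitZ _ (j.+1%:R^-1)); rewrite mulr_natl -scaler_nat scalerA mulVf ?scale1r //.
by rewrite pnatr_eq0.
Qed.

Lemma avg_split_rr k P : avg_split k P -> avg_split k.+2 (rr * P).
Proof.
move=> [a [G [hG ->]]]; exists a, (rr * G); split.
  by rewrite -[k.+2]add2n dhomogM // -[rr]expr1 (dhomog_rr 1).
rewrite mulrDr -D2rrM -scalerAr /= negbK; congr (_ *: _ + _).
by case: odd; rewrite ?mulr0 // -exprS.
Qed.

(** The reduction formula for integrals of cosine powers, made homogeneous by a factor [rr]. *)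
Lemma avg_split_cX k : avg_split k (cX ^+ k).
Proof.
have [j] := ubnP k; elim: j k => // j IHj [|[|k]] lt_kj.
- by exists 1, 0; rewrite rpred0 linear0 scale1r addr0.
- by rewrite expr1 -D2s; apply/avg_split_im; rewrite -[sX]expr1 dhomog_s.
apply: (@avg_split_natM _ k.+1).
have -> : k.+2%:R * cX ^+ k.+2 = D2 (cX ^+ k.+1 * sX) + k.+1%:R *: (rr * cX ^+ k).
  rewrite rotgenM rotgenXn D2c D2s scaler_nat -mulr_natl /rr !exprS -[k.+2]addn1 natrD.
  by ring.
apply: avg_splitD; last by apply/avg_splitZ/avg_split_rr/IHj; lia.
by apply/avg_split_im; rewrite -[k.+2]addn1 dhomogM ?dhomog_c // -[sX]expr1 dhomog_s.
Qed.

(** Squares of [sX] are traded for [rr - cX ^+ 2]; a single [sX] times a power of [cX] is an exact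
    derivative. *)
Lemma avg_split_monomial a b : avg_split (a + b) (cX ^+ a * sX ^+ b).
Proof.
have [j] := ubnP b; elim: j a b => // j IHj a [|[|b]] lt_bj.
- by rewrite addn0 mulr1; apply: avg_split_cX.
- rewrite addn1; apply: (@avg_split_natM _ a).
  have -> : a.+1%:R * (cX ^+ a * sX ^+ 1) = D2 (- cX ^+ a.+1).
    by rewrite linearN /= rotgenXn D2c expr1; ring.
  by apply/avg_split_im; rewrite rpredN dhomog_c.
have -> : cX ^+ a * sX ^+ b.+2 = rr * (cX ^+ a * sX ^+ b) + -1 *: (cX ^+ a.+2 * sX ^+ b).
  by rewrite scaleN1r /rr !exprS; ring.
apply: avg_splitD; last first.
  by apply: avg_splitZ; rewrite -addSnnS -addSnnS; apply: IHj; lia.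
by rewrite !addnS; apply/avg_split_rr/IHj; lia.
Qed.

Lemma avg_splitP k P : P \is k.-homog -> avg_split k P.
Proof.
move=> /dhomogP hP; rewrite (mpolyE P) big_seq.
elim/big_ind: _ => [||m /hP /= <-]; last 1 first.
- apply: avg_splitZ; rewrite mpolyXE_id mdegE !big_ord_recl !big_ord0 /= mulr1 addn0.
  exact: avg_split_monomial.
- by exists 0, 0; rewrite rpred0 linear0 scale0r addr0.
- exact: avg_splitD.
Qed.

(** Generators of a normal form must themselves lie in the image, so the remainder is needed as a
    second derivative. Splitting the primitive again gives it, since [D2] kills the mean. *)
Lemma avg_split2 k P : P \is k.-homog ->
  exists a G, G \is k.-homog /\ P = a *: (if odd k then 0 else rr ^+ k./2) + D2 (D2 G).
Proof.
move=> /avg_splitP [a [G [/avg_splitP [b [H [hH ->]]] ->]]]; exists a, H; split=> //.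
rewrite linearD linearZ /=; suff -> : D2 (if odd k then 0 else rr ^+ k./2) = 0.
  by rewrite scaler0 add0r.
case: odd; first exact: linear0.
by case: k./2 => [|j]; rewrite ?rotgenXn ?D2rr ?mulr0 // D2E !mderivC !mulr0 subrr.
Qed.

End Circle.

(** * Primitives of odd cosine powers and the average of their gradients *)

Section Primitive.
Context {F : realFieldType}.
Notation mpoly2 := {mpoly F[2]}.
Notation D2 := (@rotgen 2 F 0 1).
Notation c := (@cX F).
Notation s := (@sX F).

(* On the unit circle [s * cos_prim k] is the antiderivative of cos^(2k+1). *)
Fixpoint cos_prim (k : nat) : mpoly2 :=
  if k is k'.+1 then
    (2 * k + 1)%:R^-1 *: (c ^+ (2 * k) + (2 * k)%:R *: (rr * cos_prim k'))
  else 1.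

(** For [m = 2 * k.+1], [D2 (s * c ^+ m)] is [(m + 1) c ^+ (m + 1) - m rr c ^+ (m - 1)]; the
    recursive term of [cos_prim] cancels the second summand. *)
Lemma D2_cos_prim k : D2 (s * cos_prim k) = c ^+ (2 * k + 1).
Proof.
elim: k => [|k IHk]; first by rewrite mulr1 D2s expr1.
rewrite /cos_prim -/cos_prim -scalerAr rotgenZ mulrDr rotgenD -scalerAr rotgenZ.
rewrite mulrCA D2rrM IHk rotgenM D2s.
have -> : (2 * k.+1 = (2 * k).+2)%N by lia.
have nz : ((2 * k).+2 + 1)%:R != 0 :> F by rewrite pnatr_eq0.
apply: (scalerI nz); rewrite scalerA mulfV // scale1r rotgenXn D2c !scale_natr.
by rewrite /rr !addn1 !exprS; ring.
Qed.

Lemma dhomog_cos_prim k : cos_prim k \is (2 * k).-homog.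
Proof.
elim: k => [|k IHk]; first by rewrite dhomog1.
rewrite /cos_prim -/cos_prim rpredZ // rpredD ?dhomog_c // rpredZ //.
have -> : (2 * k.+1 = 2 * 1 + 2 * k)%N by lia.
by rewrite dhomogM // -[rr]expr1 dhomog_rr.
Qed.

Lemma mnonneg_c k : mnonneg (c ^+ k).
Proof. by apply/mnonnegXn/mnonnegX. Qed.

Lemma mnonneg_s k : mnonneg (s ^+ k).
Proof. by apply/mnonnegXn/mnonnegX. Qed.

Lemma mnonneg_cos_prim k : mnonneg (cos_prim k).
Proof.
elim: k => [|k IHk]; first exact: mnonneg1.
apply: mnonnegZ; first by rewrite invr_ge0 ler0n.
apply: mnonnegD; first exact: mnonneg_c.
apply: mnonnegZ; first by rewrite ler0n.
by apply: mnonnegM => //; apply: mnonnegD; [apply: mnonneg_c | apply: mnonneg_s].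
Qed.

(* With [DW = D2 W], Euler's relation expresses the gradient of [W] through [W]
   and [DW]:  rr W_c = n c W - s DW  and  rr W_s = n s W + c DW. *)
Lemma rr_grad (W : mpoly2) n : W \is n.-homog ->
  rr ^+ 2 * (W^`M(0) ^+ 2 - W^`M(1) ^+ 2) =
    (c ^+ 2 - s ^+ 2) * (n%:R ^+ 2 * W ^+ 2 - D2 W ^+ 2) - 4%:R * n%:R * (c * s * W * D2 W).
Proof.
move=> /euler_homog; rewrite !big_ord_recl big_ord0 addr0 /= => euler.
have {euler} eu : n%:R * W = c * W^`M(0) + s * W^`M(1).
  rewrite -scale_natr -euler; congr (_ * _ + _).
  by congr ('X_ _ * mderiv _ _); apply: val_inj.
have -> : n%:R ^+ 2 * W ^+ 2 = (n%:R * W) ^+ 2 by rewrite exprMn.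
have -> : 4%:R * n%:R * (c * s * W * D2 W) = 4%:R * (n%:R * W) * (c * s * D2 W) by ring.
rewrite eu D2E /rr; ring.
Qed.

(** After [rr_grad] and integration by parts, what survives is minus a multiple of the nonnegative
    [gauss X] and minus the positive excess of the moment of [c ^+ (2 * n + 2)] over that of
    [s ^+ 2 * c ^+ (2 * n)]. *)
Lemma gauss_rr_grad_lt0 k (W := s * cos_prim k) :
  gauss (rr ^+ 2 * (W^`M(0) ^+ 2 - W^`M(1) ^+ 2)) < 0.
Proof.
set n := (2 * k + 1)%N.
have hW : W \is n.-homog.
  by rewrite /n addnC dhomogM ?dhomog_cos_prim // -[s]expr1 dhomog_s.
have DW : D2 W = c ^+ n by exact: D2_cos_prim.
have W_ge0 : mnonneg W.
  by apply: mnonnegM (mnonneg_cos_prim k); rewrite -[s]expr1; apply: mnonneg_s.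
rewrite (rr_grad _ _ hW) DW; set C := c ^+ n; set X := c * s * W * C.
move: W DW W_ge0 hW @X => W DW W_ge0 hW X.
(* An exact derivative has average zero, so this trades [(c ^+ 2 - s ^+ 2) * W ^+ 2] for [- 2 X]. *)
have DW2 : D2 (c * s * W ^+ 2) = (c ^+ 2 - s ^+ 2) * W ^+ 2 + 2%:R * X.
  by rewrite expr2 !rotgenM D2c D2s DW -/C /X; ring.
have -> : (c ^+ 2 - s ^+ 2) * (n%:R ^+ 2 * W ^+ 2 - C ^+ 2) - 4%:R * n%:R * X =
    (n ^ 2)%:R *: D2 (c * s * W ^+ 2) - (2 * n ^ 2 + 4 * n)%:R *: X
      - (c * (c * C ^+ 2) - s * (s * C ^+ 2)).
  rewrite DW2 !scale_natr natrD !natrM; ring.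
rewrite !gaussB !gaussZ gauss_rotgen mulr0 sub0r.
have X_ge0 : 0 <= gauss X.
  apply: gauss_ge0; apply: mnonnegM; last exact: mnonneg_c.
  apply: mnonnegM W_ge0; rewrite -[c]expr1 -[s]expr1.
  by apply: mnonnegM; [apply: mnonneg_c | apply: mnonneg_s].
have -> : gauss (s * (s * C ^+ 2)) = (gmom (2 * n))%:R.
  rewrite gaussXM mderivM mderivXU /= mul1r -exprM.
  suff -> : (c ^+ (n * 2))^`M(1) = 0 by rewrite mulr0 addr0 gauss_Xn mulnC.
  rewrite mpolyXn mderivX mulmnE mnm1E /= mul0n scale0r //.
have -> : gauss (c * (c * C ^+ 2)) = ((2 * n).+1 * gmom (2 * n))%:R.
  by rewrite mulrA -expr2 -exprM -exprD gauss_Xn mulnC /= -gmomS; congr (gmom _)%:R; lia.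
have : (0 < (2 * n * gmom (2 * n)))%N.
  by rewrite !muln_gt0 gmom_gt0 ?oddM // /n addn1.
rewrite -(ltr_nat F) [((2 * n).+1 * _)%N]mulSn [(gmom _ + _)%N]addnC [(_ + gmom _)%:R]natrD.
rewrite addrK -opprD oppr_lt0 => pos.
by apply: ltr_wpDl => //; rewrite mulr_ge0 ?ler0n.
Qed.

Lemma gradient_average k (W := s * cos_prim k) : exists a G,
  [/\ a != 0, G \is (4 * k).-homog &
      W^`M(0) ^+ 2 - W^`M(1) ^+ 2 = a *: rr ^+ (2 * k) + D2 (D2 G)].
Proof.
have hW : W \is (2 * k).+1.-homog.
  by rewrite -[(2 * k).+1]add1n dhomogM ?dhomog_cos_prim // -[s]expr1 dhomog_s.
have hP : W^`M(0) ^+ 2 - W^`M(1) ^+ 2 \is (4 * k).-homog.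
  have -> : (4 * k = 2 * k * 2)%N by lia.
  by rewrite rpredB // dhomogMn ?dhomog_deriv.
have [a [G [hG eq_P]]] := avg_split2 _ _ hP.
have o4 : odd (4 * k) = false by rewrite oddM.
have h4 : (4 * k)./2 = (2 * k)%N by lia.
rewrite o4 h4 in eq_P.
(* Multiplication by [rr ^+ 2] commutes with [D2], so [a = 0] would give an exact derivative, of
   average zero rather than negative. *)
exists a, G; split=> //; apply: contraTneq (gauss_rr_grad_lt0 k) => a0.
by rewrite -/W eq_P a0 scale0r add0r expr2 -mulrA -!D2rrM gauss_rotgen ltxx.
Qed.

(** Even moments are positive, so [a] can be divided by when a potential of prescribed average is
    sought. *)
Lemma power_average k : exists a G,
  [/\ a != 0, G \is (2 * k).-homog & c ^+ (2 * k) = a *: rr ^+ k + D2 (D2 G)].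
Proof.
have [a [G [hG eq_P]]] := avg_split2 _ _ (dhomog_c (F := F) (2 * k)).
have o2 : odd (2 * k) = false by rewrite oddM.
have h2 : (2 * k)./2 = k by lia.
rewrite o2 h2 in eq_P; exists a, G; split=> //; apply/negP => /eqP a0.
have : gauss (c ^+ (2 * k)) = 0 by rewrite eq_P a0 scale0r add0r gauss_rotgen.
by rewrite gauss_Xn => /eqP; rewrite pnatr_eq0 -leqn0 leqNgt gmom_gt0 ?oddM.
Qed.

(** In odd degree the mean vanishes; this places the first generator in the image, as [inImD]
    requires. *)
Lemma cos_prim_im k : exists G, G \is (2 * k + 1).-homog /\ D2 G = s * cos_prim k.
Proof.
have hW : s * cos_prim k \is (2 * k + 1).-homog.
  by rewrite addnC dhomogM ?dhomog_cos_prim // -[s]expr1 dhomog_s.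
have [a [G [hG ->]]] := avg_splitP _ _ hW.
have o2 : odd (2 * k + 1) by rewrite addn1 /= oddM.
by exists G; rewrite o2 scaler0 add0r.
Qed.

End Primitive.

(** * Uniqueness of the normal form *)

Section NormalForm.
Implicit Types K G W P : {mpoly R[4]}.

Lemma DopE P : Dop P = rotgen (i4 0) (i4 2) P + rotgen (i4 1) (i4 3) P.
Proof. by rewrite /Dop !big_ord_recl big_ord0 addr0. Qed.

Lemma Dop_is_linear : linear Dop.
Proof. by move=> c P Q; rewrite !DopE !rotgenD !rotgenZ [in RHS]scalerDr addrACA. Qed.

HB.instance Definition _ :=
  GRing.isLinear.Build R {mpoly R[4]} {mpoly R[4]} _ Dop Dop_is_linear.

Lemma DopB P Q : Dop (P - Q) = Dop P - Dop Q.
Proof. exact: linearB. Qed.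

Lemma dhomog_Dop k P : P \is k.-homog -> Dop P \is k.-homog.
Proof. by move=> hP; rewrite DopE rpredD ?dhomog_rotgen. Qed.

Lemma mord_Dop e P : mord e P -> mord e (Dop P).
Proof.
case: e => [|e] oP; first by move=> m.
have oXd i j : mord e.+1 ('X_i * P^`M(j)).
  by rewrite -[e.+1]add1n; apply: mordM; [apply: mordX | apply: mord_deriv].
by rewrite DopE; apply: mordD; apply: mordB.
Qed.

Lemma fischer_Dop P Q : fischer (Dop P) Q = - fischer P (Dop Q).
Proof.
rewrite !DopE fischerDl !fischer_rotgen -opprD; congr (- _).
by rewrite [RHS]fischerC fischerDl; congr (_ + _); apply: fischerC.
Qed.

(** Skewness gives [fischer P P = fischer (Dop F) P = - fischer F (Dop P) = 0]. *)
Lemma ker_im_Dop P F : Dop P = 0 -> Dop F = P -> P = 0.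
Proof.
move=> kerP imP; apply: fischer_eq0; rewrite -{1}imP fischer_Dop kerP fischerC.
by apply/eqP; rewrite oppr_eq0; apply/eqP/linear0.
Qed.

Lemma comp_harm (A : 4.-tuple {mpoly R[4]}) :
  harm \mPo A = 2%:R^-1 *: (\sum_(i < 4) tnth A i ^+ 2).
Proof.
rewrite /harm linearZ linear_sum; congr (_ *: _); apply: eq_bigr => i _.
by rewrite /= rmorphXn /= comp_mpolyXU -tnth_nth.
Qed.

(** To leading order two effects survive: the change of polynomial, taken at the identity
    substitution, and the change of argument in [harm], whose partial derivatives are the ['X_i]. *)
Lemma mord_comp_linearize k K K' (A B : 4.-tuple {mpoly R[4]}) :
    mord 3 (K - harm) -> mord k.+2 (K - K') ->
    (forall i, mord 2 (tnth A i - 'X_i)) -> (forall i, mord 2 (tnth B i - 'X_i)) ->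
    (forall i, mord k.+1 (tnth A i - tnth B i)) ->
  mord k.+3 ((K \mPo A) - (K' \mPo B) - (K - K')
    - \sum_(i < 4) 'X_i * (tnth A i - tnth B i)).
Proof.
move=> oK oKK' oA oB oAB; pose X : 4.-tuple {mpoly R[4]} := [tuple 'X_i | i < 4].
have ord1 (C : 4.-tuple {mpoly R[4]}) i : mord 2 (tnth C i - 'X_i) -> mord 1 (tnth C i).
  by move=> oC; rewrite -[tnth C i](subrK 'X_i); apply: mordD (mordX i); apply: mordW oC.
have o1 : mord k.+3 (((K - harm) \mPo A) - ((K - harm) \mPo B)).
  by rewrite -[k.+3]/(3 + k)%N; apply: mord_comp => // i; apply: ord1.
have o2 : mord (k.+2 + 1) (((K - K') \mPo B) - ((K - K') \mPo X)).
  apply: mord_comp => // i; [exact: ord1 | | ]; rewrite tnth_mktuple //; exact: mordX.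
(* The error in linearizing [harm]: half of [A ^+ 2 - B ^+ 2], minus [X * (A - B)], factors as half
   of [(A - B) * ((A - X) + (B - X))]. *)
have o3 : mord (k.+1 + 2) (\sum_(i < 4) (tnth A i - tnth B i) *
    (2%:R^-1 *: ((tnth A i - 'X_i) + (tnth B i - 'X_i)))).
  by apply: mord_sum => i _; apply: mordM => //; apply/mordZ/mordD.
rewrite !addnS !addn0 in o2 o3.
have e1 : \sum_(i < 4) (tnth A i - tnth B i) *
    (2%:R^-1 *: ((tnth A i - 'X_i) + (tnth B i - 'X_i))) =
    (harm \mPo A) - (harm \mPo B) - \sum_(i < 4) 'X_i * (tnth A i - tnth B i).
  rewrite !comp_harm -scalerBr -sumrB scaler_sumr -sumrB; apply: eq_bigr => i _.
  have two0 : 2%:R != 0 :> R by rewrite pnatr_eq0.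
  apply: (scalerI two0); rewrite scalerBr -scalerAr !scalerA mulfV // !scale1r scale_natr.
  by ring.
rewrite e1 in o3.
have -> : (K \mPo A) - (K' \mPo B) - (K - K')
    - \sum_(i < 4) 'X_i * (tnth A i - tnth B i) =
  (((K - harm) \mPo A) - ((K - harm) \mPo B)) + (((K - K') \mPo B) - ((K - K') \mPo X))
  + ((harm \mPo A) - (harm \mPo B) - \sum_(i < 4) 'X_i * (tnth A i - tnth B i)).
  by rewrite comp_mpoly_id !comp_mpolyB; ring.
by apply: mordD => //; apply: mordD.
Qed.

Definition idW : {mpoly R[4]} := \sum_(j < 2) 'X_(i4 j) * 'X_(i4 (j + 2)).

Definition tupK W : 4.-tuple {mpoly R[4]} :=
  [tuple (if (i < 2)%N then 'X_i else W^`M(i4 (i - 2))) | i < 4].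
Definition tupG W : 4.-tuple {mpoly R[4]} :=
  [tuple (if (i < 2)%N then W^`M(i4 (i + 2)) else 'X_i) | i < 4].

Lemma ord4P (C : 'I_4 -> Prop) : C (i4 0) -> C (i4 1) -> C (i4 2) -> C (i4 3) -> forall i, C i.
Proof.
move=> c0 c1 c2 c3 [[|[|[|[|m]]]] lt_m4] //.
- by congr C: c0; apply: val_inj; rewrite /= inordK.
- by congr C: c1; apply: val_inj; rewrite /= inordK.
- by congr C: c2; apply: val_inj; rewrite /= inordK.
- by congr C: c3; apply: val_inj; rewrite /= inordK.
Qed.

Lemma big_ord4 (M : nmodType) (F : 'I_4 -> M) :
  \sum_i F i = F (i4 0) + F (i4 1) + F (i4 2) + F (i4 3).
Proof.
rewrite !big_ord_recl big_ord0 addr0 !addrA; do ![congr (_ + _)]; congr (F _);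
  by apply: val_inj; rewrite /= inordK.
Qed.

Lemma i4K k : (k < 4)%N -> i4 k = k :> nat.
Proof. exact: inordK. Qed.

Lemma i4_eq j k : (j < 4)%N -> (k < 4)%N -> (i4 j == i4 k) = (j == k).
Proof. by move=> hj hk; rewrite -val_eqE /= !i4K. Qed.

Lemma mderiv_idW : [/\ idW^`M(i4 0) = 'X_(i4 2), idW^`M(i4 1) = 'X_(i4 3),
  idW^`M(i4 2) = 'X_(i4 0) & idW^`M(i4 3) = 'X_(i4 1)].
Proof.
rewrite /idW !big_ord_recl big_ord0 addr0 /=.
by split; rewrite !mderivD !mderivM !mderivXU !i4_eq //=
  !(mul0r, mul1r, mulr0, mulr1, addr0, add0r).
Qed.

Lemma mord_tupK W i : mord 3 (W - idW) -> mord 2 (tnth (tupK W) i - 'X_i).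
Proof.
move=> oW; have oD j : mord 2 (W^`M(j) - idW^`M(j)) by rewrite -mderivB; apply: mord_deriv.
case: mderiv_idW (oD (i4 0)) (oD (i4 1)) => -> -> _ _ o0 o1.
move: i; apply: ord4P; rewrite tnth_mktuple i4K //= ?subrr //; exact: mord0.
Qed.

Lemma mord_tupG W i : mord 3 (W - idW) -> mord 2 (tnth (tupG W) i - 'X_i).
Proof.
move=> oW; have oD j : mord 2 (W^`M(j) - idW^`M(j)) by rewrite -mderivB; apply: mord_deriv.
case: mderiv_idW (oD (i4 2)) (oD (i4 3)) => _ _ -> -> o0 o1.
move: i; apply: ord4P; rewrite tnth_mktuple i4K //= ?subrr //; exact: mord0.
Qed.

(** The homological equation. Linearizing leaves [eta] times the [q]-derivatives of [W - W'] from
    [K], minus [q] times its [eta]-derivatives from [G]; together these are [- Dop (W - W')]. *)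
Lemma normal_form_step k K K' G G' W W' :
    mord 3 (K - harm) -> mord 3 (G - harm) -> mord 3 (W - idW) -> mord 3 (W' - idW) ->
    mord k.+2 (K - K') -> mord k.+2 (G - G') -> mord k.+2 (W - W') ->
    mord k.+3 (substK K W - substG G W) -> mord k.+3 (substK K' W' - substG G' W') ->
  mord k.+3 (K - K' - Dop (W - W') - (G - G')).
Proof.
move=> oK oG oW oW' oKK' oGG' oWW' oE oE'.
have oD j : mord k.+1 (W^`M(j) - W'^`M(j)) by rewrite -mderivB; apply: mord_deriv.
have SK : mord k.+3 ((K \mPo tupK W) - (K' \mPo tupK W') - (K - K')
    - \sum_(i < 4) 'X_i * (tnth (tupK W) i - tnth (tupK W') i)).
  apply: mord_comp_linearize => //; try by move=> i; apply: mord_tupK.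
  by apply: ord4P; rewrite !tnth_mktuple i4K //= ?subrr; try exact: mord0; apply: oD.
have SG : mord k.+3 ((G \mPo tupG W) - (G' \mPo tupG W') - (G - G')
    - \sum_(i < 4) 'X_i * (tnth (tupG W) i - tnth (tupG W') i)).
  apply: mord_comp_linearize => //; try by move=> i; apply: mord_tupG.
  by apply: ord4P; rewrite !tnth_mktuple i4K //= ?subrr; try exact: mord0; apply: oD.
rewrite big_ord4 !tnth_mktuple !i4K //= in SK.
rewrite big_ord4 !tnth_mktuple !i4K //= in SG.
have := mordD _ _ _ (mordB _ _ _ oE oE') (mordB _ _ _ SG SK).
congr (mord _ _); rewrite DopE /rotgen !mderivB /substK /substG.
rewrite -/(tupK W) -/(tupK W') -/(tupG W) -/(tupG W').
by ring.
Qed.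

End NormalForm.

(** * Comparison of two normal forms degree by degree *)

Section Uniqueness.
Implicit Types K G W P : {mpoly R[4]}.

Definition genW (Wk : nat -> {mpoly R[4]}) (rho : nat) : {mpoly R[4]} :=
  idW + \sum_(3 <= k < rho.+1) Wk k.

Lemma mord_sum_nat e rho (a : nat -> {mpoly R[4]}) :
  (forall k, (3 <= k <= rho)%N -> mord e (a k)) -> mord e (\sum_(3 <= k < rho.+1) a k).
Proof. by move=> h; rewrite big_nat_cond; apply: mord_sum => k; rewrite andbT ltnS; apply: h. Qed.

Lemma sum_lead rho k (a : nat -> {mpoly R[4]}) :
    (3 <= k <= rho)%N -> (forall j, (3 <= j <= rho)%N -> a j \is j.-homog) ->
    (forall j, (3 <= j < k)%N -> a j = 0) ->
  mord k.+1 (\sum_(3 <= j < rho.+1) a j - a k).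
Proof.
move=> hk hom zero; rewrite (@bigD1_seq _ _ _ _ _ k) ?iota_uniq ?mem_index_iota ?ltnS //=.
rewrite [a k + _]addrC addrK big_nat_cond; apply: mord_sum => j; rewrite ltnS => /andP[hj ne_jk].
have [lt_jk|le_kj] := ltnP j k; last by apply: (@mordW _ _ j); [lia | apply/dhomog_mord/hom].
by rewrite zero; [apply: mord0 | lia].
Qed.

Section Data.
Variables (rho : nat) (K K' : {mpoly R[4]}) (Gk Gk' Wk Wk' : nat -> {mpoly R[4]}).
Let G := harm + \sum_(3 <= k < rho.+1) Gk k.
Let G' := harm + \sum_(3 <= k < rho.+1) Gk' k.
Let W := genW Wk rho.
Let W' := genW Wk' rho.
Hypothesis kerG : forall k, (3 <= k <= rho)%N -> inKerD k (Gk k).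
Hypothesis kerG' : forall k, (3 <= k <= rho)%N -> inKerD k (Gk' k).
Hypothesis imW : forall k, (3 <= k <= rho)%N -> inImD k (Wk k).
Hypothesis imW' : forall k, (3 <= k <= rho)%N -> inImD k (Wk' k).
Hypothesis oK : mord 3 (K - harm).
Hypothesis nfE : noLowTerms rho (substK K W - substG G W).
Hypothesis nfE' : noLowTerms rho (substK K' W' - substG G' W').

Lemma normal_form_lead k : (3 <= k <= rho)%N ->
    (forall j, (3 <= j < k)%N -> Gk j = Gk' j /\ Wk j = Wk' j) -> mord k (K - K') ->
  mord k.+1 (K - K' - Dop (Wk k - Wk' k) - (Gk k - Gk' k)).
Proof.
move=> hk agree oKK'.
have oG : mord 3 (G - harm).
  rewrite /G addrAC subrr add0r; apply: mord_sum_nat => j hj.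
  by apply: (@mordW _ _ j); [lia | apply: dhomog_mord; case: (kerG _ hj)].
have oW (Vk : nat -> {mpoly R[4]}) :
    (forall k, (3 <= k <= rho)%N -> inImD k (Vk k)) -> mord 3 (genW Vk rho - idW).
  move=> imV; rewrite /genW addrAC subrr add0r; apply: mord_sum_nat => j hj.
  by apply: (@mordW _ _ j); [lia | apply: dhomog_mord; case: (imV _ hj)].
have GG' : G - G' = \sum_(3 <= j < rho.+1) (Gk j - Gk' j).
  by rewrite sumrB opprD addrACA subrr add0r.
have WW' : W - W' = \sum_(3 <= j < rho.+1) (Wk j - Wk' j).
  by rewrite sumrB opprD addrACA subrr add0r.
have leadG : mord k.+1 (G - G' - (Gk k - Gk' k)).
  rewrite GG'; apply: (@sum_lead _ _ (fun j => Gk j - Gk' j)) => // j hj.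
    by case: (kerG _ hj) (kerG' _ hj) => hG _ [hG' _]; apply: rpredB.
  by case: (agree j hj) => -> _; rewrite subrr.
have leadW : mord k.+1 (W - W' - (Wk k - Wk' k)).
  rewrite WW'; apply: (@sum_lead _ _ (fun j => Wk j - Wk' j)) => // j hj.
    by case: (imW _ hj) (imW' _ hj) => hG _ [hG' _]; apply: rpredB.
  by case: (agree j hj) => _ ->; rewrite subrr.
have hGk : Gk k - Gk' k \is k.-homog.
  by case: (kerG _ hk) (kerG' _ hk) => hG _ [hG' _]; apply: rpredB.
have hWk : Wk k - Wk' k \is k.-homog.
  by case: (imW _ hk) (imW' _ hk) => hG _ [hG' _]; apply: rpredB.
have oGG' : mord k (G - G').
  rewrite -[G - G'](subrK (Gk k - Gk' k)); apply: mordD; last exact: dhomog_mord.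
  exact: mordW leadG.
have oWW' : mord k (W - W').
  rewrite -[W - W'](subrK (Wk k - Wk' k)); apply: mordD; last exact: dhomog_mord.
  exact: mordW leadW.
have low : mord k.+1 (K - K' - Dop (W - W') - (G - G')).
  have k2 : k = k.-2.+2 by lia.
  rewrite k2; apply: normal_form_step; rewrite -?k2 //; try exact: oW.
    by apply: (mordW rho.+1 _ _ _ nfE); lia.
  by apply: (mordW rho.+1 _ _ _ nfE'); lia.
have := mordD _ _ _ (mordD _ _ _ low leadG) (mord_Dop _ _ leadW).
congr (mord _ _); rewrite [Dop (W - W' - _)]DopB; ring.
Qed.

(** Strong induction on the degree: the homological equation becomes
    [Dop (Wk k - Wk' k) + (Gk k - Gk' k) = 0], and the kernel and image of [Dop] meet trivially. *)
Lemma normal_form_agree k0 : (k0 <= rho.+1)%N -> mord k0 (K - K') ->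
  forall k, (3 <= k < k0)%N -> Gk k = Gk' k /\ Wk k = Wk' k.
Proof.
move=> le_k0 oKK' k; have [n] := ubnP k; elim: n k => // n IHn k lt_kn hk.
have hk' : (3 <= k <= rho)%N by lia.
have agree j : (3 <= j < k)%N -> Gk j = Gk' j /\ Wk j = Wk' j.
  by move=> hj; apply: IHn; lia.
have low := normal_form_lead _ hk' agree (mordW k0 k _ ltac:(lia) oKK').
have {low} low : mord k.+1 (Dop (Wk k - Wk' k) + (Gk k - Gk' k)).
  have := mordB _ _ _ (mordW k0 k.+1 _ ltac:(lia) oKK') low.
  by congr (mord _ _); ring.
case: (kerG _ hk') (kerG' _ hk') => hG kG [hG' kG'].
case: (imW _ hk') (imW' _ hk') => hW [F [hF DF]] [hW' [F' [hF' DF']]].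
have sum0 : Dop (Wk k - Wk' k) + (Gk k - Gk' k) = 0.
  apply: (dhomog_mord_eq0 k) => //; apply: rpredD; last exact: rpredB.
  exact/dhomog_Dop/rpredB.
have G0 : Gk k - Gk' k = 0.
  apply: (ker_im_Dop _ (- (Wk k - Wk' k))); first by rewrite DopB kG kG' subrr.
  by apply/eqP; rewrite linearN /= -subr_eq0 -opprD oppr_eq0 sum0.
split; first by apply/eqP; rewrite -subr_eq0 G0.
(* [Wk k - Wk' k] is an image by hypothesis, and lies in the kernel now that the [Gk] parts
   agree. *)
apply/eqP; rewrite -subr_eq0; apply/eqP; apply: (ker_im_Dop _ (F - F')).
  by rewrite G0 addr0 in sum0.
by rewrite DopB DF DF'.
Qed.

End Data.

Lemma isBGNF_unique K rho G G' : mord 3 (K - harm) ->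
  isBGNF K rho G -> isBGNF K rho G' -> G = G'.
Proof.
move=> oK [Gk [kG [-> [Wk [iW nf]]]]] [Gk' [kG' [-> [Wk' [iW' nf']]]]].
congr (_ + _); apply: eq_big_nat => k hk.
have oKK : mord rho.+1 (K - K) by rewrite subrr; apply: mord0.
by have [] := normal_form_agree _ _ _ _ _ _ _ kG kG' iW iW' oK nf nf' _ (leqnn _) oKK k hk.
Qed.

(** All parts agree below [rho]; in degree [rho] the homological equation with equal kernel parts
    leaves [K - K'] in the image. *)
Lemma sameBGNF_lead K K' rho G : (3 <= rho)%N -> mord 3 (K - harm) ->
    K - K' \is rho.-homog -> isBGNF K rho G -> isBGNF K' rho G ->
  exists F, K - K' = Dop F.
Proof.
move=> le3 oK hKK' [Gk [kG [eG [Wk [iW nf]]]]] [Gk' [kG' [eG' [Wk' [iW' nf']]]]].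
have oKK' := dhomog_mord _ _ hKK'.
have hr : (3 <= rho <= rho)%N by rewrite le3 /=.
move: nf nf'; rewrite {1}eG {1}eG' => nf nf'.
have agree := normal_form_agree _ _ _ _ _ _ _ kG kG' iW iW' oK nf nf' _ (leqnSn _) oKK'.
have low := normal_form_lead _ _ _ _ _ _ _ kG kG' iW iW' oK nf nf' _ hr agree oKK'.
(* Only the total [G] is shared, so its component in degree [rho] is recovered from the vanishing
   sum of differences. *)
have GG' : Gk rho = Gk' rho.
  apply/eqP; rewrite -subr_eq0; apply/eqP.
  apply: (dhomog_mord_eq0 rho).
    by case: (kG _ hr) (kG' _ hr) => hG _ [hG' _]; apply: rpredB.
  have := @sum_lead rho rho (fun j => Gk j - Gk' j) hr.
  have -> : \sum_(3 <= j < rho.+1) (Gk j - Gk' j) = 0.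
    by rewrite sumrB; apply/eqP; rewrite subr_eq0 -(inj_eq (addrI harm)) -eG -eG'.
  rewrite sub0r => h; rewrite -[_ - _]opprK; apply: mordN; apply: h => j hj.
    by case: (kG _ hj) (kG' _ hj) => hG _ [hG' _]; apply: rpredB.
  by case: (agree j hj) => -> _; rewrite subrr.
exists (Wk rho - Wk' rho); apply/eqP; rewrite -subr_eq0; apply/eqP.
rewrite GG' subrr subr0 in low; apply: (dhomog_mord_eq0 rho) => //.
apply: rpredB => //; apply/dhomog_Dop.
by case: (iW _ hr) (iW' _ hr) => hW _ [hW' _]; apply: rpredB.
Qed.

End Uniqueness.

(** * Lifting from one plane *)

Section ChainRule.
Context {n k : nat} {S : comNzRingType}.
Variable A : n.-tuple {mpoly S[k]}.
Implicit Types P Q : {mpoly S[n]}.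

Lemma mpoly_ring_ind (C : {mpoly S[n]} -> Prop) :
    (forall c P Q, C P -> C Q -> C (c *: P + Q)) -> C 0 -> C 1 -> (forall i, C 'X_i) ->
    (forall P Q, C P -> C Q -> C (P * Q)) ->
  forall P, C P.
Proof.
move=> CD C0 C1 CX CM; apply: mpoly_linear_ind => // m; rewrite mpolyXE_id.
apply: big_ind => // i _; elim: (m i) => // j IHj; rewrite exprS; exact: CM.
Qed.

Lemma mderiv_comp i P :
  (P \mPo A)^`M(i) = \sum_j (P^`M(j) \mPo A) * (tnth A j)^`M(i).
Proof.
move: P; apply: mpoly_ring_ind => [c P Q IHP IHQ|||l|P Q IHP IHQ].
- rewrite linearP /= mderivD mderivZ IHP IHQ scaler_sumr -big_split; apply: eq_bigr => j _.
  by rewrite mderivD mderivZ comp_mpolyD comp_mpolyZ mulrDl scalerAl.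
- rewrite comp_mpoly0 mderiv0 big1 // => j _.
  by rewrite mderiv0 comp_mpoly0 mul0r.
- rewrite comp_mpoly1 mderivC big1 // => j _.
  by rewrite mderivC comp_mpoly0 mul0r.
- rewrite comp_mpolyXU -tnth_nth (bigD1 l) //= mderivXU eqxx comp_mpoly1 mul1r big1 ?addr0 //.
  by move=> j /negbTE ne; rewrite mderivXU ne comp_mpoly0 mul0r.
- rewrite rmorphM /= mderivM IHP IHQ mulr_suml mulr_sumr -big_split; apply: eq_bigr => j _.
  by rewrite mderivM comp_mpolyD !rmorphM /=; ring.
Qed.

Lemma rotgen_comp i j P :
  rotgen i j (P \mPo A) = \sum_l (P^`M(l) \mPo A) * rotgen i j (tnth A l).
Proof.
rewrite /rotgen !mderiv_comp !mulr_sumr -sumrB; apply: eq_bigr => l _.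
by ring.
Qed.

Lemma dhomog_comp d P : (forall i, tnth A i \is 1.-homog) -> P \is d.-homog ->
  P \mPo A \is d.-homog.
Proof.
move=> hA /dhomogP hP; rewrite comp_mpolyEX big_seq; apply: rpred_sum => m /hP <-.
apply: rpredZ; rewrite comp_mpolyX /= mdegE; elim/big_ind2: _ => [|x e y f hx hy|i _].
- exact: dhomog1.
- exact: dhomogM.
- by have := dhomogMn (m i) (hA i); rewrite mul1n.
Qed.

End ChainRule.

Lemma big_ord2 (M : nmodType) (f : 'I_2 -> M) : \sum_i f i = f 0 + f 1.
Proof.
by rewrite !big_ord_recl big_ord0 addr0; congr (_ + f _); apply: val_inj.
Qed.

Section Lift.
Variables a b : R.

(* The ring map sending functions of [(c, s)] to functions of
   [(a q_1 + b q_2, a p_1 + b p_2)]. *)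
Definition lin_form (i j : nat) : {mpoly R[4]} := a *: 'X_(i4 i) + b *: 'X_(i4 j).
Definition lift_tup : 2.-tuple {mpoly R[4]} := [tuple lin_form 0 1; lin_form 2 3].
Definition lift (P : {mpoly R[2]}) : {mpoly R[4]} := P \mPo lift_tup.

Lemma lift_c : lift cX = lin_form 0 1.
Proof. by rewrite /lift comp_mpolyXU. Qed.

Lemma liftD P Q : lift (P + Q) = lift P + lift Q.
Proof. exact: comp_mpolyD. Qed.

Lemma liftZ c P : lift (c *: P) = c *: lift P.
Proof. exact: comp_mpolyZ. Qed.

Lemma liftB P Q : lift (P - Q) = lift P - lift Q.
Proof. exact: comp_mpolyB. Qed.

Lemma liftM P Q : lift (P * Q) = lift P * lift Q.
Proof. exact: rmorphM. Qed.

Lemma liftXn P k : lift (P ^+ k) = lift P ^+ k.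
Proof. exact: rmorphXn. Qed.

Lemma mderiv_lift P : [/\ (lift P)^`M(i4 0) = a *: lift P^`M(0),
  (lift P)^`M(i4 1) = b *: lift P^`M(0), (lift P)^`M(i4 2) = a *: lift P^`M(1)
  & (lift P)^`M(i4 3) = b *: lift P^`M(1)].
Proof.
split; rewrite mderiv_comp big_ord2 /lift_tup !(tnth_nth 0) /= /lin_form;
  rewrite !mderivD !mderivZ !mderivXU !i4_eq //= !(scaler0, add0r, addr0, mulr0);
  by rewrite -scalerAr mulr1.
Qed.

(** The same [a] and [b] combine positions and momenta, so [Dop] acts on the two linear forms as
    [rotgen 0 1] acts on [cX] and [sX]. *)
Lemma Dop_lift P : Dop (lift P) = lift (rotgen 0 1 P).
Proof.
case: (mderiv_lift P) => e0 e1 e2 e3.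
rewrite DopE /rotgen e0 e1 e2 e3 liftB !liftM lift_c.
have -> : lift 'X_1 = lin_form 2 3 by rewrite /lift comp_mpolyXU.
by rewrite /lin_form !mulrDl -!scalerAr -!scalerAl opprD addrACA.
Qed.

Lemma dhomog_lift k P : P \is k.-homog -> lift P \is k.-homog.
Proof.
apply: dhomog_comp => -[[|[|i]] lt_i2] //; rewrite (tnth_nth 0) /=;
  by rewrite rpredD // rpredZ // dhomogXU.
Qed.

End Lift.

(** The quadratic effect of a generator [U] on [harm]; see [harm_expand]. *)
Definition dgrad (U : {mpoly R[4]}) : {mpoly R[4]} :=
  2%:R^-1 *: (U^`M(i4 0) ^+ 2 + U^`M(i4 1) ^+ 2 - (U^`M(i4 2) ^+ 2 + U^`M(i4 3) ^+ 2)).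

(* The cross terms cancel because [(a, b)] and [(- b, a)] are orthogonal. *)
Lemma dgrad_lift a b x y (P Q : {mpoly R[2]}) : a ^+ 2 + b ^+ 2 = 1 ->
  dgrad (x *: lift a b P + y *: lift (- b) a Q) =
    2%:R^-1 *: (x ^+ 2 *: lift a b (P^`M(0) ^+ 2 - P^`M(1) ^+ 2)
                + y ^+ 2 *: lift (- b) a (Q^`M(0) ^+ 2 - Q^`M(1) ^+ 2)).
Proof.
move=> ab1; case: (mderiv_lift a b P) (mderiv_lift (- b) a Q) => e0 e1 e2 e3 [f0 f1 f2 f3].
rewrite /dgrad !mderivD !mderivZ e0 e1 e2 e3 f0 f1 f2 f3 !liftB !liftXn; congr (_ *: _).
rewrite -!mul_mpolyC !rmorphN !rmorphXn /=.
have : (a%:MP ^+ 2 + b%:MP ^+ 2 = 1 :> {mpoly R[4]}) by rewrite -!rmorphXn -rmorphD /= ab1.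
move: (a%:MP) (b%:MP) (x%:MP) (y%:MP) (lift _ _ _) (lift _ _ _) (lift _ _ _) (lift _ _ _).
move=> A B X Y q p' p q' AB1.
transitivity ((A ^+ 2 + B ^+ 2) *
  (X ^+ 2 * (q' ^+ 2 - p' ^+ 2) + Y ^+ 2 * (p ^+ 2 - q ^+ 2))); first by ring.
by rewrite AB1 mul1r.
Qed.

(** * Existence of the normal form *)

Section Existence.
Implicit Types (V g U : {mpoly R[4]}).

(** Exact since [harm] is quadratic; the terms linear in [U] form [- Dop U]. *)
Lemma harm_expand (U : {mpoly R[4]}) :
  substK harm (idW + U) - substG harm (idW + U) = dgrad U - Dop U.
Proof.
rewrite /substK /substG !comp_harm !big_ord4 !tnth_mktuple !i4K //=.
case: mderiv_idW => d0 d1 d2 d3; rewrite !mderivD d0 d1 d2 d3 DopE /rotgen /dgrad.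
have two0 : 2%:R != 0 :> R by rewrite pnatr_eq0.
apply: (scalerI two0); rewrite !scalerBr !scalerA mulfV // !scale1r !scale_natr.
by ring.
Qed.

(** As [g] sits in the top degree [rho], substituting into it changes only degrees above [rho]. *)
Lemma isBGNF_intro rho V g (Wk : nat -> {mpoly R[4]}) :
    (3 <= rho)%N -> (forall W, substK V W = V) -> inKerD rho g ->
    (forall k, (3 <= k <= rho)%N -> inImD k (Wk k)) ->
    (let U := \sum_(3 <= k < rho.+1) Wk k in mord rho.+1 (V - g + dgrad U - Dop U)) ->
  isBGNF (harm + V) rho (harm + g).
Proof.
move=> le3 VW kerg imW low; pose Gk k := if k == rho then g else 0.
exists Gk; split; first by move=> k _; rewrite /Gk; case: eqP => [->|_] //; split;
  [apply: rpred0 | apply: linear0].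
split.
  by rewrite -big_mkcond big_nat1_eq ltnS leqnn le3.
exists Wk; split=> // W; rewrite /W -/idW; set U := \sum_(_ <= k < _) _ in low *.
have oU : mord 3 (idW + U - idW).
  rewrite addrAC subrr add0r; apply: mord_sum_nat => j hj.
  by apply: (@mordW _ _ j); [lia | apply: dhomog_mord; case: (imW _ hj)].
have ord1 i : mord 1 (tnth (tupG (idW + U)) i).
  rewrite -[tnth _ _](subrK 'X_i); apply: mordD (mordX i).
  by apply: (@mordW _ _ 2) => //; apply: mord_tupG.
have og : mord (rho + 1) ((g \mPo tupG (idW + U)) - (g \mPo [tuple 'X_i | i < 4])).
  apply: mord_comp => // [i|i|]; rewrite ?tnth_mktuple; first exact: mordX.
    by have := mord_tupG _ i oU; rewrite tnth_mktuple.
  by apply: dhomog_mord; case: kerg.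
have := mordB _ _ _ low _; rewrite -[rho.+1]addn1 => /(_ _ og); rewrite addn1.
congr (mord _ _); rewrite comp_mpoly_id.
rewrite {1}/substK {1}/substG !comp_mpolyD -/(substK harm _) -/(substG harm _).
rewrite -/(tupG (idW + U)) -/(substK V _) VW.
have -> : forall x y z t : {mpoly R[4]}, x + y - (z + t) = (x - z) + y - t by move=> *; ring.
by rewrite harm_expand; move: (dgrad U) (Dop U) (g \mPo _) => p q r; ring.
Qed.

Lemma mord_dgrad e (U : {mpoly R[4]}) : mord e.+1 U -> mord (e + e) (dgrad U).
Proof.
move=> oU; have o2 i : mord (e + e) (U^`M(i) ^+ 2).
  by rewrite expr2; apply: mordM; apply: mord_deriv.
by apply: mordZ; apply: mordB; apply: mordD.
Qed.

Lemma mord_dgradD d e (U U' : {mpoly R[4]}) : (d <= e)%N -> mord d.+1 U -> mord e.+1 U' ->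
  mord (d + e) (dgrad (U + U') - dgrad U).
Proof.
move=> le_de oU oU'.
have o2 i : mord (d + e) (U'^`M(i) * (2%:R * U^`M(i) + U'^`M(i))).
  rewrite addnC; apply: mordM; first exact: mord_deriv.
  apply: mordD; last by apply: (@mordW _ _ e) => //; apply: mord_deriv.
  by rewrite -scale_natr; apply/mordZ/mord_deriv.
rewrite /dgrad -scalerBr !mderivD; apply: mordZ.
have := mordB _ _ _ (mordD _ _ _ (o2 (i4 0)) (o2 (i4 1))) (mordD _ _ _ (o2 (i4 2)) (o2 (i4 3))).
by congr (mord _ _); ring.
Qed.

Lemma inImD0 k : inImD k 0.
Proof. by split; rewrite ?rpred0 //; exists 0; rewrite rpred0 linear0. Qed.

Lemma sum_nat_pick rho j (a : {mpoly R[4]}) : (3 <= j <= rho)%N ->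
  \sum_(3 <= k < rho.+1) (if k == j then a else 0) = a.
Proof. by move=> hj; rewrite -big_mkcond big_nat1_eq ltnS hj. Qed.

(** Since [rho >= 3], the quadratic effect of [w] has order [2 * (rho - 1) > rho]. *)
Lemma isBGNF_leading rho V g w :
    (3 <= rho)%N -> (forall W, substK V W = V) -> inKerD rho g -> inImD rho w ->
    V - g = Dop w ->
  isBGNF (harm + V) rho (harm + g).
Proof.
move=> le3 VW kerg imw eV; pose Wk k := if k == rho then w else 0.
apply: (@isBGNF_intro _ _ _ Wk) => //.
  by move=> k _; rewrite /Wk; case: eqP => [->|_] //; apply: inImD0.
rewrite /= /Wk sum_nat_pick ?le3 ?leqnn // eV addrAC subrr add0r.
apply: (@mordW _ _ (rho.-1 + rho.-1)); first by lia.
by apply: mord_dgrad; rewrite prednK; [apply: dhomog_mord; case: imw | lia].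
Qed.

(** The generator [w] cancels [V], its quadratic effect in degree [2 * d - 2] splits into [g] and
    [Dop w'], and the remaining terms have order at least [(d - 1) + (rho - 1) > rho]. *)
Lemma isBGNF_second_order d rho V g w w' :
    (3 <= d)%N -> rho = (2 * d - 2)%N -> (forall W, substK V W = V) ->
    inKerD rho g -> inImD d w -> inImD rho w' -> V = Dop w -> dgrad w - g = Dop w' ->
  isBGNF (harm + V) rho (harm + g).
Proof.
move=> le3 def_rho VW kerg imw imw' eV eB.
pose Wk k := (if k == d then w else 0) + (if k == rho then w' else 0).
apply: (@isBGNF_intro _ _ _ Wk) => //; first by lia.
  move=> k _; rewrite /Wk; have [->|_] := eqVneq k d.
    by rewrite (_ : (d == rho) = false) ?addr0 //; lia.
  by rewrite add0r; case: eqP => [->|_] //; apply: inImD0.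
rewrite /= /Wk big_split /= !sum_nat_pick; try lia.
have -> : V - g + dgrad (w + w') - Dop (w + w') = dgrad (w + w') - dgrad w.
  rewrite eV linearD /= -eB.
  by move: (Dop w) (dgrad (w + w')) (dgrad w) => p q r; rewrite opprD addrA opprB; ring.
apply: (@mordW _ _ (d.-1 + rho.-1)); first by lia.
apply: mord_dgradD; first by lia.
  by rewrite prednK; [apply: dhomog_mord; case: imw | lia].
by rewrite prednK; [apply: dhomog_mord; case: imw' | lia].
Qed.

End Existence.

(** * Separated potentials *)

Section Potential.
Context {d : nat}.
Implicit Types v : 'I_d.+1 -> R.

Definition phoTail v : {mpoly R[4]} :=
  \sum_(h < d.+1) (v h * ('C(d, h))%:R) *: ('X_(i4 0) ^+ h * 'X_(i4 1) ^+ (d - h)).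

Lemma phoHamE v : phoHam v = harm + phoTail v.
Proof. by []. Qed.

Lemma eq_phoHam v v' : v =1 v' -> phoHam v = phoHam v'.
Proof. by move=> eq_v; congr (_ + _); apply: eq_bigr => h _; rewrite eq_v. Qed.

Lemma phoPot_eval v x : (phoPot v).@[x] =
  \sum_(h < d.+1) v h * ('C(d, h))%:R * (x (inord 0) ^+ h * x (inord 1) ^+ (d - h)).
Proof.
rewrite /phoPot raddf_sum; apply: eq_bigr => h _.
by rewrite /= mevalZ mevalM !rmorphXn /= !mevalXU.
Qed.

Lemma dhomog_phoTail v : phoTail v \is d.-homog.
Proof.
apply: rpred_sum => h _; apply: rpredZ.
have hX i j : ('X_i : {mpoly R[4]}) ^+ j \is j.-homog.
  by have := dhomogMn j (dhomogXU (S := R) i); rewrite mul1n.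
by have := dhomogM (hX (i4 0) h) (hX (i4 1) (d - h)%N); rewrite subnKC // -ltnS.
Qed.

Lemma substK_phoTail v W : substK (phoTail v) W = phoTail v.
Proof.
rewrite /substK /phoTail linear_sum; apply: eq_bigr => h _.
by rewrite linearZ rmorphM !rmorphXn /= !comp_mpolyXU -!tnth_nth !tnth_mktuple !i4K.
Qed.

Lemma mord3_phoHam v : (3 <= d)%N -> mord 3 (phoHam v - harm).
Proof.
move=> le3; rewrite phoHamE addrAC subrr add0r; apply: (@mordW _ _ d) => //.
exact/dhomog_mord/dhomog_phoTail.
Qed.

(** At [q_2 = 1] the difference is a univariate polynomial with coefficients
    [(v h - v' h) * 'C(d, h)] that vanishes at every real number. *)
Lemma phoPot_inj v v' : (forall x, (phoPot v).@[x] = (phoPot v').@[x]) -> v =1 v'.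
Proof.
move=> eq_vv' h; pose E (i : nat) : R := (v (inord i) - v' (inord i)) * ('C(d, i))%:R.
pose p : {poly R} := \poly_(i < d.+1) E i.
have p_eval t : p.[t] = 0.
  rewrite horner_poly; pose x (i : 'I_2) : R := if i == inord 0 then t else 1.
  have n01 : (inord 1 == inord 0 :> 'I_2) = false by rewrite -val_eqE /= !inordK.
  have := eq_vv' x; rewrite !phoPot_eval => /eqP; rewrite -subr_eq0 -sumrB => /eqP e; rewrite -[RHS]e.
  apply: eq_bigr => i _; rewrite /E inord_val /x eqxx n01 expr1n mulr1.
  by rewrite -!mulrBl.
have p0 : p = 0.
  apply/eqP; apply: contraTT isT => p_neq0.
  have := max_poly_roots p_neq0 (rs := [seq i%:R | i <- iota 0 (size p)]).
  rewrite size_map size_iota ltnn; apply.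
    by apply/allP => t _; rewrite rootE p_eval.
  by rewrite map_inj_uniq ?iota_uniq // => i j /eqP; rewrite eqr_nat => /eqP.
have := coef_poly d.+1 E h; rewrite -/p p0 coef0 ltn_ord /E inord_val => /esym/eqP.
rewrite mulf_eq0 subr_eq0 pnatr_eq0 -leqn0 leqNgt bin_gt0 -ltnS ltn_ord orbF.
by move/eqP.
Qed.

(** The circle [(q, p) = (x cos t, x sin t)], with [cX] and [sX] for the cosine and sine. *)
Definition line_tup (x : 'I_2 -> R) : 4.-tuple {mpoly R[2]} :=
  [tuple x (inord 0) *: cX; x (inord 1) *: cX; x (inord 0) *: sX; x (inord 1) *: sX].

Lemma phoTail_line v x : phoTail v \mPo line_tup x = (phoPot v).@[x] *: cX ^+ d.
Proof.
rewrite phoPot_eval scaler_suml /phoTail linear_sum; apply: eq_bigr => h _.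
rewrite linearZ rmorphM !rmorphXn /= !comp_mpolyXU !i4K //= !exprZn -[in RHS]scalerA; congr (_ *: _).
by rewrite -scalerAl -scalerAr scalerA -exprD subnKC // -ltnS.
Qed.

End Potential.

(** These circles are orbits of the flow generated by [Dop]. *)
Lemma rotgen_line x (P : {mpoly R[4]}) :
  rotgen 0 1 (P \mPo line_tup x) = Dop P \mPo line_tup x.
Proof.
rewrite rotgen_comp big_ord4 !(tnth_nth 0) !i4K //= !rotgenZ D2c D2s DopE.
rewrite /rotgen linearD !linearB /= !rmorphM /= !comp_mpolyXU !i4K //=.
rewrite -!mul_mpolyC; ring.
Qed.

(* The average of [V(x cos t)] over the circle is a positive multiple of [V(x)]. *)
Lemma phoTail_im_eq d (v v' : 'I_d.+1 -> R) F :
  ~~ odd d -> phoTail v - phoTail v' = Dop F -> v =1 v'.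
Proof.
move=> even_d eq_F; apply: phoPot_inj => x.
have := congr1 (fun P => gauss (P \mPo line_tup x)) eq_F.
rewrite -rotgen_line gauss_rotgen comp_mpolyB !phoTail_line -scalerBl gaussZ gauss_Xn.
move/eqP; rewrite mulf_eq0 subr_eq0 pnatr_eq0 -leqn0 leqNgt gmom_gt0 // orbF.
by move/eqP.
Qed.

Section Separated.
Variables (a b : R) (d : nat).
Hypothesis unit_ab : a ^+ 2 + b ^+ 2 = 1.

(** With the binomials factored out, the coefficients of [x (a q_1 + b q_2)^d + y (- b q_1 + a
    q_2)^d]. *)
Definition sep_coef (x y : R) (h : 'I_d.+1) : R :=
  x * (a ^+ h * b ^+ (d - h)) + y * ((- b) ^+ h * a ^+ (d - h)).

(** A general algebra covers both polynomials and, through [R^o], values. *)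
Lemma sep_binomial (A : comAlgType R) (X Y : A) x y :
  \sum_(h < d.+1) (sep_coef x y h * ('C(d, h))%:R) *: (X ^+ h * Y ^+ (d - h)) =
  x *: (a *: X + b *: Y) ^+ d + y *: (- b *: X + a *: Y) ^+ d.
Proof.
rewrite (addrC (a *: X)) (addrC (- b *: X)) !exprDn !scaler_sumr -big_split.
apply: eq_bigr => h _ /=; set C := 'C(d, h).
have term p q : (q *: Y) ^+ (d - h) * (p *: X) ^+ h *+ C =
    (p ^+ h * q ^+ (d - h) * C%:R) *: (X ^+ h * Y ^+ (d - h)).
  rewrite !exprZn -scalerAl -scalerAr !scalerA -scaler_nat scalerA [Y ^+ _ * _]mulrC.
  by congr (_ *: _); ring.
by rewrite !term !scalerA -scalerDl; congr (_ *: _); rewrite /sep_coef mulrDl -!mulrA.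
Qed.

Lemma sep_tail x y :
  phoTail (sep_coef x y) = x *: lift a b (cX ^+ d) + y *: lift (- b) a (cX ^+ d).
Proof. by rewrite /phoTail sep_binomial !liftXn !lift_c. Qed.

Lemma sep_eval x y z : (phoPot (sep_coef x y)).@[z] =
  x * (a * z (inord 0) + b * z (inord 1)) ^+ d
  + y * (- b * z (inord 0) + a * z (inord 1)) ^+ d.
Proof. by rewrite phoPot_eval; apply: (@sep_binomial R^o). Qed.

(** Each of the points [(a, b)] and [(- b, a)] kills one linear form and gives the other the value
    1. *)
Lemma sep_neq0 x y : (0 < d)%N -> x != 0 \/ y != 0 -> phoPot (sep_coef x y) != 0.
Proof.
move=> d_gt0 nz; apply/negP => /eqP pot0.
have n01 : (inord 1 == inord 0 :> 'I_2) = false by rewrite -val_eqE /= !inordK.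
pose z (p q : R) (i : 'I_2) : R := if i == inord 0 then p else q.
have ev p q : x * (a * p + b * q) ^+ d + y * (- b * p + a * q) ^+ d = 0.
  by have := sep_eval x y (z p q); rewrite pot0 meval0 /z eqxx n01.
have := ev a b; have := ev (- b) a => {ev}.
have -> : a * - b + b * a = 0 by ring.
have -> : - b * a + a * b = 0 by ring.
have -> : - b * - b + a * a = 1 by rewrite -unit_ab; ring.
have -> : a * a + b * b = 1 by rewrite -unit_ab; ring.
rewrite !expr0n (gtn_eqF d_gt0) !expr1n !mulr0 !mulr1 add0r addr0 => y0 x0.
by case: nz; rewrite ?x0 ?y0 eqxx.
Qed.

End Separated.

(** * The rotation [sigma psi] and separability within it *)

Section Sigma.
Variable psi : R.

Lemma cos2Dsin2 : cos psi ^+ 2 + (- sin psi) ^+ 2 = 1.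
Proof. by rewrite sqrrN addrC !expr2; apply: sin2_cos2. Qed.

Lemma sigma_unit : Defs.sigma psi \in unitmx.
Proof.
suff /mulmx1_unit[] : Defs.sigma psi *m (Defs.sigma psi)^T = 1%:M by [].
have := cos2Dsin2; rewrite sqrrN !expr2 => cs1.
apply/matrixP => -[[|[|i]] lt_i] [[|[|j]] lt_j] //; rewrite !mxE big_ord2 !mxE -val_eqE /=.
- by rewrite mulrNN.
- by ring.
- by ring.
- by rewrite addrC.
Qed.

Lemma sigma_mul (x : 'cV[R]_2) :
  (Defs.sigma psi *m x) (inord 0) 0 = cos psi * x (inord 0) 0 + - sin psi * x (inord 1) 0 /\
  (Defs.sigma psi *m x) (inord 1) 0 = - - sin psi * x (inord 0) 0 + cos psi * x (inord 1) 0.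
Proof.
have -> : inord 0 = 0 :> 'I_2 by apply: val_inj; rewrite /= inordK.
have -> : inord 1 = 1 :> 'I_2 by apply: val_inj; rewrite /= inordK.
by rewrite !mxE !big_ord2 !mxE /= opprK.
Qed.

Lemma sigmaK x : rotinv psi (Defs.sigma psi *m x) = x.
Proof. exact/mulKmx/sigma_unit. Qed.

Lemma rotinvK x : Defs.sigma psi *m rotinv psi x = x.
Proof. exact/mulKVmx/sigma_unit. Qed.

Lemma separable_coef d (v : 'I_d.+1 -> R) : separable_within v psi ->
  exists x y, (x != 0 \/ y != 0) /\ v =1 sep_coef (cos psi) (- sin psi) d x y.
Proof.
(* The order is swapped: [vt0] belongs to the second rotated coordinate, whose coefficient in
   [sep_coef] is [y]. *)
move=> [y [x [nz sepv]]]; exists x, y; split; first by case: nz; [right | left].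
apply: phoPot_inj => z; rewrite sep_eval.
pose zc : 'cV[R]_2 := \col_i z i.
case: (sigma_mul zc) => e0 e1; have := sepv (Defs.sigma psi *m zc); rewrite e0 e1 !mxE addrC => <-.
by apply: meval_eq => i; rewrite sigmaK mxE.
Qed.

End Sigma.

(* For [a = cos psi] and [b = - sin psi] these are the Hamiltonians separated
   within [sigma psi]. *)
Lemma separated_normal_forms (a b x y : R) (k : nat) : (1 <= k)%N ->
    a ^+ 2 + b ^+ 2 = 1 -> x != 0 \/ y != 0 ->
  exists x' y', (x' != 0 \/ y' != 0) /\
    sameBGNF (phoHam (sep_coef a b (2 * k + 1) x y)) (phoHam (sep_coef a b (4 * k) x' y')) (4 * k).
Proof.
move=> k_gt0 ab1 nz.
have [s [G [s_neq0 hG eqG]]] := @gradient_average R k.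
have [t [H [t_neq0 hH eqH]]] := @power_average R (2 * k).
have [W0 [hW0 DW0]] := @cos_prim_im R k.
have cancel (p q r u : {mpoly R[4]}) : p + q + (r + u) - (p + r) = q + u by ring.
have e4 : (2 * (2 * k) = 4 * k)%N by lia.
rewrite e4 in hH eqH.
(* Coefficient in the normal form: 1/2 and the square from [dgrad], [s] from [gradient_average]. *)
pose z (u : R) := 2%:R^-1 * u ^+ 2 * s.
pose L P Q u w := u *: lift a b P + w *: lift (- b) a Q.
have DopL P Q u w : Dop (L P Q u w) = L (rotgen 0 1 P) (rotgen 0 1 Q) u w.
  by rewrite /L linearD /= !linearZ /= !Dop_lift.
have homL d P u w : P \is d.-homog -> L P P u w \is d.-homog.
  by move=> hP; rewrite /L rpredD // rpredZ // dhomog_lift.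
have linL c P Q u w :
    L (c *: P + Q) (c *: P + Q) u w - L P P (u * c) (w * c) = L Q Q u w.
  by rewrite /L !liftD !liftZ !scalerDr !scalerA cancel.
pose g := L (rr ^+ (2 * k)) (rr ^+ (2 * k)) (z x) (z y).
have kerg : inKerD (4 * k) g.
  split; first by apply: homL; rewrite -e4 dhomog_rr.
  have Drr : rotgen 0 1 ((rr : {mpoly R[2]}) ^+ (2 * k)) = 0.
    have -> : (2 * k = (2 * k).-1.+1)%N by lia.
    by rewrite rotgenXn D2rr mulr0.
  by rewrite DopL Drr /L /lift !comp_mpoly0 !scaler0 addr0.
(* Dividing by [t], the circle average of [cX ^+ (4 * k)], gives the even potential the kernel part
   [g]. *)
exists (z x / t), (z y / t); split.
  have nz2 u : u != 0 -> z u / t != 0.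
    by move=> u0; rewrite !mulf_neq0 ?invr_neq0 ?expf_neq0 ?pnatr_eq0.
  by case: nz => /nz2; [left | right].
pose w := L (sX * cos_prim k) (sX * cos_prim k) x y.
exists (harm + g); split; rewrite phoHamE.
  (* The second generator is a [Dop] image because [gradient_average] leaves a double derivative. *)
  apply: (@isBGNF_second_order (2 * k + 1) _ _ _ w
    (Dop (L G G (2%:R^-1 * x ^+ 2) (2%:R^-1 * y ^+ 2)))) => //; try lia.
  - exact: substK_phoTail.
  - split; last by exists (L W0 W0 x y); split; [apply: homL | rewrite DopL DW0].
    by apply: homL; rewrite -DW0 dhomog_rotgen.
  - have hL : L G G (2%:R^-1 * x ^+ 2) (2%:R^-1 * y ^+ 2) \is (4 * k).-homog by exact: homL.
    by split; [apply: dhomog_Dop | exists (L G G (2%:R^-1 * x ^+ 2) (2%:R^-1 * y ^+ 2))].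
  - by rewrite sep_tail DopL D2_cos_prim.
  by rewrite dgrad_lift // eqG scalerDr !scalerA !DopL -(linL s (rr ^+ (2 * k))).
pose w' := L H H (z x / t) (z y / t).
have hw' : w' \is (4 * k).-homog by exact: homL.
apply: (@isBGNF_leading _ _ _ (Dop w')) => //; first by lia.
- exact: substK_phoTail.
- by split; [apply: dhomog_Dop | exists w'].
by rewrite sep_tail eqH !DopL -(linL t (rr ^+ (2 * k))) !divfK.
Qed.

Theorem mainTheorem6 (delta : nat) (v : 'I_delta.+1 -> R) (psi : R) :
  (3 <= delta)%N -> odd delta ->
  phoPot v != 0 ->
  0 <= psi < 2 * PI ->
  separable_within v psi ->
  exists K' : {mpoly R[4]},
    [/\ isPHO (2 * delta - 2) K' /\ sameBGNF (phoHam v) K' (2 * delta - 2),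
        (forall K'' : {mpoly R[4]},
           isPHO (2 * delta - 2) K'' /\ sameBGNF (phoHam v) K'' (2 * delta - 2) ->
           K'' = K') &
        exists wt0 wtd : R,
          forall qt pt : 'cV[R]_2,
            K'.@[rotpt psi qt pt]
              = (2%:R)^-1 * (\sum_(j < 2) (pt j 0 ^+ 2 + qt j 0 ^+ 2))
                + wt0 * qt (inord 1) 0 ^+ (2 * delta - 2)
                + wtd * qt (inord 0) 0 ^+ (2 * delta - 2)].
Proof.
move=> le3 odd_d _ _ /separable_coef [x [y [nz /eq_phoHam ->]]].
have ab1 := cos2Dsin2 psi; set a := cos psi in ab1 *; set b := - sin psi in ab1 *.
have [k def_d] : exists k, delta = (2 * k + 1)%N by exists delta./2; lia.
have k_gt0 : (0 < k)%N by lia.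
have -> : (2 * delta - 2 = 4 * k)%N by lia.
have [x' [y' [nz' same]]] := separated_normal_forms _ _ _ _ _ k_gt0 ab1 nz.
rewrite -def_d in same; set v' := sep_coef a b (4 * k) x' y' in same.
have le3' : (3 <= 4 * k)%N by lia.
exists (phoHam v'); split.
- by split=> //; exists v'; split=> //; apply: sep_neq0 => //; lia.
(* Uniqueness of the odd Hamiltonian's normal form makes both even ones share it; their difference
   is then in the image, which forces equal potentials. *)
- move=> _ [[v'' [_ ->]] [G'' [nf nf'']]]; case: same => G' [nf1 nf1'].
  have eG : G' = G'' by apply: isBGNF_unique nf1 nf; apply: mord3_phoHam.
  rewrite eG in nf1'.
  have hom : phoHam v'' - phoHam v' \is (4 * k).-homog.
    by rewrite !phoHamE opprD addrACA subrr add0r rpredB // dhomog_phoTail.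
  have [F eqF] := sameBGNF_lead _ _ _ _ le3' (mord3_phoHam _ le3') hom nf'' nf1'.
  rewrite !phoHamE opprD addrACA subrr add0r in eqF.
  by apply/eq_phoHam/(phoTail_im_eq _ _ _ _ _ eqF); rewrite oddM.
exists y', x' => qt pt.
have [q0 q1] := sigma_mul psi (rotinv psi qt); have [p0 p1] := sigma_mul psi (rotinv psi pt).
rewrite rotinvK -/a -/b in q0 q1; rewrite rotinvK -/a -/b in p0 p1.
have r0 : inord 0 = 0 :> 'I_2 by apply: val_inj; rewrite /= inordK.
have r1 : inord 1 = 1 :> 'I_2 by apply: val_inj; rewrite /= inordK.
rewrite phoHamE sep_tail mevalD !mevalD !mevalZ !liftXn !lift_c !rmorphXn /=.
rewrite /lin_form !mevalD !mevalZ !mevalXU raddf_sum big_ord4 big_ord2.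
rewrite /= !rmorphXn /= !mevalXU /rotpt !i4K //= -r0 -r1 q0 q1 p0 p1.
set Q0 := rotinv psi qt _ _; set Q1 := rotinv psi qt _ _.
set P0 := rotinv psi pt _ _; set P1 := rotinv psi pt _ _.
rewrite [X in _ + X]addrC addrA; congr (_ * _ + _ + _).
(* The harmonic part is rotation invariant. *)
transitivity ((a ^+ 2 + b ^+ 2) * (Q0 ^+ 2 + Q1 ^+ 2 + P0 ^+ 2 + P1 ^+ 2)).
  by rewrite ab1 mul1r.
by ring.
Qed.
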